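(* There is a pure state on $\mathcal{B}(\ell_2)$ which is not diagonalizable. That is, there exists a pure state $\phi$ on the C*-algebra $\mathcal{B}(\ell_2)$ such that there are no orthonormal basis $(e_k)_{k\in\mathbb{N}}$ of $\ell_2$ and ultrafilter $u$ on $\mathbb{N}$ for which $\phi(T)=\lim_u\langle T(e_k),e_k\rangle$ holds for all $T\in\mathcal{B}(\ell_2)$.
   Context: $\ell_2=\ell_2(\mathbb{N})$ is the complex separable infinite-dimensional Hilbert space and $\mathcal{B}(\ell_2)$ is the C*-algebra of all bounded linear operators on it. A state on a C*-algebra is a positive linear functional of norm one; a pure state is a state which is not a (nontrivial) convex combination of other states, i.e. an extreme point of the set of states. Ultrafilters on $\mathbb{N}$ may be principal or nonprincipal. For an ultrafilter $u$ on $\mathbb{N}$ and $z_k,z\in\mathbb{C}$, $\lim_u z_k=z$ means that for every $\varepsilon>0$ the set $\{k\in\mathbb{N}:|z_k-z|<\varepsilon\}$ belongs to $u$. The result is a theorem of ZFC (no additional set-theoretic hypotheses). *)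

(* Defs.v *)
From HB Require Import structures.
From mathcomp Require Import all_boot all_order all_algebra.
From mathcomp Require Import all_classical all_reals all_analysis.
From mathcomp Require Import complex lra.

Set Implicit Arguments.
Unset Strict Implicit.
Unset Printing Implicit Defensive.

Import Order.TTheory GRing.Theory Num.Theory.
Import numFieldNormedType.Exports.

Local Open Scope classical_set_scope.
Local Open Scope ring_scope.
Local Open Scope complex_scope.

(* The real-valued modulus; the norm `|z| on R[i] takes its values in R[i]. *)
Notation normc := ComplexField.Normc.normc.

Section SquareSummable.
Variable R : realType.
Implicit Types x y : nat -> R[i]^o.

Definition sqr_series x : R^nat := series (fun n => normc (x n) ^+ 2).

Definition square_summable : {pred nat -> R[i]^o} :=
  [pred x | `[< cvgn (sqr_series x) >]].

Lemma square_summableP x :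
  reflect (cvgn (sqr_series x)) (x \in square_summable).
Proof. exact: asboolP. Qed.

Lemma sqr_normcD_le (a b : R[i]) :
  normc (a + b) ^+ 2 <= 2 * normc a ^+ 2 + 2 * normc b ^+ 2.
Proof.
case: a b => [a1 a2] [b1 b2] /=.
rewrite !sqr_sqrtr ?addr_ge0 ?sqr_ge0//.
have := sqr_ge0 (a1 - b1); have := sqr_ge0 (a2 - b2).
by rewrite !sqrrB !sqrrD; lra.
Qed.

Lemma sqr_seriesZ a x : sqr_series (a *: x) = normc a ^+ 2 *: sqr_series x.
Proof.
rewrite /sqr_series -seriesZ; congr series; apply/funext => n.
by rewrite !scalrfctE /GRing.scale /= ComplexField.Normc.normcM exprMn.
Qed.

Lemma cvg_sqr_series2 x y : cvgn (sqr_series x) -> cvgn (sqr_series y) ->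
  cvgn (series (fun n => 2 * normc (x n) ^+ 2 + 2 * normc (y n) ^+ 2)).
Proof.
move=> cx cy.
have c2x := @is_cvg_seriesZ _ _ 2 cx; have c2y := @is_cvg_seriesZ _ _ 2 cy.
exact: is_cvg_seriesD c2x c2y.
Qed.

Lemma cvg_sqr_seriesD x y : cvgn (sqr_series x) -> cvgn (sqr_series y) ->
  cvgn (sqr_series (x + y)).
Proof.
move=> cx cy; apply: series_le_cvg (cvg_sqr_series2 cx cy) => n.
- exact: sqr_ge0.
- by rewrite addr_ge0// mulr_ge0// sqr_ge0.
- exact: sqr_normcD_le.
Qed.

Lemma square_summable_submod_closed : submod_closed square_summable.
Proof.
split=> [|a x y].
  apply/square_summableP; rewrite -(scale0r (0 : nat -> R[i]^o)).
  rewrite sqr_seriesZ ComplexField.Normc.normc0 expr0n /= scale0r.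
  exact: is_cvg_cst.
move=> /square_summableP cx /square_summableP cy; apply/square_summableP.
apply: cvg_sqr_seriesD => //.
by rewrite sqr_seriesZ; exact: is_cvgZl_tmp.
Qed.

HB.instance Definition _ :=
  GRing.isSubmodClosed.Build _ _ square_summable square_summable_submod_closed.

Record ell2 := Ell2 {
  ell2_val :> nat -> R[i]^o;
  ell2_valP : ell2_val \in square_summable }.

HB.instance Definition _ := [isSub for ell2_val].
HB.instance Definition _ := [Choice of ell2 by <:].
HB.instance Definition _ := [SubChoice_isSubLmodule of ell2 by <:].

End SquareSummable.

Section Operators.
Variable R : realType.
Notation H := (ell2 R).

(* Conjugate-linear in the second argument; the complex series is summed
   through its real and imaginary parts. *)
Definition inner (x y : H) : R[i] :=
  limn (series (fun n => complex.Re (x n * (y n)^*))) +i*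
  limn (series (fun n => complex.Im (x n * (y n)^*))).

Definition norm2 (x : H) : R := Num.sqrt (limn (sqr_series x)).

Lemma norm2_ge0 (x : H) : 0 <= norm2 x. Proof. exact: sqrtr_ge0. Qed.

Lemma ell2_cvg (x : H) : cvgn (sqr_series x).
Proof. exact/square_summableP/ell2_valP. Qed.

Lemma sqr_norm2 (x : H) : norm2 x ^+ 2 = limn (sqr_series x).
Proof.
rewrite sqr_sqrtr//; apply: limr_ge; first exact: ell2_cvg.
by apply: nearW => n; apply: sumr_ge0 => k _; exact: sqr_ge0.
Qed.

Lemma norm2Z a (x : H) : norm2 (a *: x) = normc a * norm2 x.
Proof.
rewrite /norm2 [X in limn X]sqr_seriesZ limZl_tmp; last exact: ell2_cvg.
rewrite sqrtrM ?sqr_ge0// sqrtr_sqr ger0_norm//.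
by case: a => ? ?; exact: sqrtr_ge0.
Qed.

Lemma norm2D_le (x y : H) : norm2 (x + y) <= 2 * (norm2 x + norm2 y).
Proof.
have cx : cvgn (sqr_series x) := @ell2_cvg x.
have cy : cvgn (sqr_series y) := @ell2_cvg y.
have n0 := norm2_ge0; rewrite -(@ler_pXn2r _ 2)//; last first.
- by rewrite nnegrE mulr_ge0// addr_ge0.
- by rewrite nnegrE.
apply: (@le_trans _ _ (2 * norm2 x ^+ 2 + 2 * norm2 y ^+ 2)).
  rewrite !sqr_norm2.
  have c2x := @is_cvg_seriesZ _ _ 2 cx; have c2y := @is_cvg_seriesZ _ _ 2 cy.
  rewrite -[2 * limn (sqr_series x)](@lim_seriesZ _ _ 2 cx).
  rewrite -[2 * limn (sqr_series y)](@lim_seriesZ _ _ 2 cy) -lim_seriesD//.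
  apply: lim_series_le; last by move=> n; exact: sqr_normcD_le.
  - exact: (@ell2_cvg (x + y)).
  - exact: cvg_sqr_series2 cx cy.
by have := n0 x; have := n0 y; nra.
Qed.

Definition bounded_linear : {pred H -> H} :=
  [pred T | `[< linear T /\ exists M : R, forall x, norm2 (T x) <= M * norm2 x >]].

Lemma bounded_linearP (T : H -> H) :
  reflect (linear T /\ exists M : R, forall x, norm2 (T x) <= M * norm2 x)
          (T \in bounded_linear).
Proof. exact: asboolP. Qed.

Lemma bounded_linear_submod_closed : submod_closed bounded_linear.
Proof.
split=> [|a S T].
  apply/bounded_linearP; split=> [b x y|]; first by rewrite scaler0 addr0.
  exists 0 => x; have -> : (0 : H -> H) x = 0 *: x by rewrite scale0r.
  by rewrite norm2Z ComplexField.Normc.normc0.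
move=> /bounded_linearP[lS [M SM]] /bounded_linearP[lT [N TN]].
apply/bounded_linearP; split.
  move=> b x y; rewrite !fctE lS lT !scalerDr !scalerA (mulrC a b).
  by rewrite -!addrA; congr (_ + _); rewrite addrCA.
exists (2 * (normc a * M + N)) => x.
apply: (le_trans (norm2D_le _ _)); rewrite -mulrA ler_pM2l// mulrDl lerD//.
rewrite norm2Z -mulrA ler_wpM2l//.
by case: (a) => ? ?; exact: sqrtr_ge0.
Qed.

HB.instance Definition _ :=
  GRing.isSubmodClosed.Build _ _ bounded_linear bounded_linear_submod_closed.

Record bop := Bop { bop_val :> H -> H; bop_valP : bop_val \in bounded_linear }.

HB.instance Definition _ := [isSub for bop_val].
HB.instance Definition _ := [Choice of bop by <:].
HB.instance Definition _ := [SubChoice_isSubLmodule of bop by <:].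

Lemma comp_bounded_linear (S T : bop) : (S \o T) \in bounded_linear.
Proof.
have /bounded_linearP[lS [M SM]] := bop_valP S.
have /bounded_linearP[lT [N TN]] := bop_valP T.
apply/bounded_linearP; split.
  by move=> a x y /=; rewrite lT lS.
exists (`|M| * N) => x; apply: (le_trans (SM _)); rewrite -mulrA.
apply: (@le_trans _ _ (`|M| * norm2 (T x))); last by rewrite ler_wpM2l.
by rewrite ler_wpM2r ?norm2_ge0 ?ler_norm.
Qed.

Definition bop_comp (S T : bop) : bop := Bop (comp_bounded_linear S T).

Definition is_adjoint (T S : bop) : Prop :=
  forall x y : H, inner (T x) y = inner x (S y).

Definition opnorm (T : bop) : \bar R :=
  ereal_sup [set (norm2 (T x))%:E | x in [set x : H | norm2 x <= 1]].

Definition funnorm (phi : bop -> R[i]) : \bar R :=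
  ereal_sup
    [set (normc (phi T))%:E | T in [set T : bop | (opnorm T <= 1)%E]].

(* Positivity is phi (S^* S) >= 0 for all S: every bounded S has exactly one
   adjoint S'. In R[i], [0 <= z] means that z is real and nonnegative. *)
Definition is_state (phi : bop -> R[i]) : Prop :=
  [/\ scalar phi,
      forall S S' : bop, is_adjoint S S' -> 0 <= phi (bop_comp S' S)
    & funnorm phi = 1%E].

Definition is_pure_state (phi : bop -> R[i]) : Prop :=
  is_state phi /\
  forall (psi1 psi2 : bop -> R[i]) (t : R), is_state psi1 -> is_state psi2 ->
    0 < t < 1 ->
    (forall T, phi T = t%:C * psi1 T + (1 - t)%:C * psi2 T) ->
    psi1 = phi /\ psi2 = phi.

Definition orthonormal_basis (e : nat -> H) : Prop :=
  (forall i j, inner (e i) (e j) = (i == j)%:R) /\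
  (forall (x : H) (eps : R), 0 < eps ->
    exists n (c : nat -> R[i]), norm2 (x - \sum_(k < n) c k *: e k) < eps).

Definition ulim (u : set_system nat) (z : nat -> R[i]) (l : R[i]) : Prop :=
  forall eps : R, 0 < eps -> u [set k | normc (z k - l) < eps].

Definition diagonalizable_state (phi : bop -> R[i]) : Prop :=
  exists (e : nat -> H) (u : set_system nat),
    [/\ orthonormal_basis e, UltraFilter u
      & forall T : bop, ulim u (fun k => inner (T (e k)) (e k)) (phi T)].

End Operators.

(* Main.v *)
(** The space is cut into finite-dimensional blocks, block [n] being the [n]-th
    tensor power of [R^(F_q * F_q)] for a large prime [q = q_n]. A polynomial
    [p] of degree at most [2n] gives the normalized indicator [w_p] of its
    graph; distinct [w_p] are nearly orthogonal, and there are more of them than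
    the dimension of the block. Let [A_p = 1 - (1 - w_p w_p^T)^{(x) n}]. Any [n]
    of these projections have a common fixed unit vector [w_1 (x) ... (x) w_n],
    whereas a given vector is nearly fixed by few of them. Choosing one [p] in
    each block gives a projection [P_f] of [ell2]; finitely many [P_f] have a
    common fixed unit vector, but by counting and Bessel's inequality every
    orthonormal family [e] admits an [f] with [Re <P_f e_k, e_k> <= 7/8] for all
    [k]. A pure state with value 1 at all [P_f] is thus not diagonalizable.

    Such a state is obtained from Zorn's lemma on sublinear functionals: one cuts
    the operator norm so that it becomes linear on a cone containing the [P_f],
    and takes a minimal sublinear functional below the result among those whose
    dominated linear functionals form a face. Minimality forces it to be linear
    and extreme. *)

Require Import Defs.
From mathcomp Require Import all_boot all_order all_algebra.
From mathcomp Require Import all_classical all_reals all_analysis.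
From mathcomp Require Import complex ring lra.

Set Implicit Arguments.
Unset Strict Implicit.
Unset Printing Implicit Defensive.

Import Order.TTheory GRing.Theory Num.Theory.
Import numFieldNormedType.Exports.

Local Open Scope classical_set_scope.
Local Open Scope ring_scope.
Local Open Scope complex_scope.

(** * Extreme points below a sublinear functional *)

Section SublinearExtreme.
Variables (R : realType) (V : lmodType R[i]).
Implicit Types (p q u : V -> R) (C : set V).

Definition sublinear q : Prop :=
  (forall x y, q (x + y) <= q x + q y) /\
  (forall (c : R) x, 0 <= c -> q (c%:C *: x) = c * q x).

Definition real_linear u : Prop :=
  (forall x y, u (x + y) = u x + u y) /\
  (forall (c : R) x, u (c%:C *: x) = c * u x).

(* The linear functionals below [q] form a face of those below [p]. *)
Definition facial p q : Prop :=
  forall (t : R) u1 u2, 0 < t < 1 -> real_linear u1 -> real_linear u2 ->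
    (forall x, u1 x <= p x) -> (forall x, u2 x <= p x) ->
    (forall x, t * u1 x + (1 - t) * u2 x <= q x) ->
    (forall x, u1 x <= q x) /\ (forall x, u2 x <= q x).

Definition convex_cone C : Prop :=
  [/\ C 0, forall x y, C x -> C y -> C (x + y)
    & forall (c : R) x, 0 <= c -> C x -> C (c%:C *: x)].

Definition additive_on C q : Prop :=
  forall x y, C x -> C y -> q (x + y) = q x + q y.

(** If [q] is sublinear and additive on the cone [C], the linear functionals below [cut q C] are
    those below [q] that agree with [q] on [C]. *)
Definition cut q C x : R := inf [set q (x + s) - q s | s in C].

Lemma sublinear0 q : sublinear q -> q 0 = 0.
Proof. by move=> [_ qZ]; have := qZ 0 0 (lexx _); rewrite mul0r scale0r. Qed.

Lemma sublinearN q x : sublinear q -> - q (- x) <= q x.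
Proof.
move=> sq; have [qD _] := sq.
by have := qD x (- x); rewrite subrr sublinear0//; lra.
Qed.

Lemma sublinear_additive_linear q : sublinear q ->
  (forall x y, q x + q y <= q (x + y)) -> real_linear q.
Proof.
move=> sq qD'; have [qD qZ] := sq.
have qA x y : q (x + y) = q x + q y by apply/eqP; rewrite eq_le qD qD'.
have qN x : q (- x) = - q x.
  by apply/eqP; rewrite -addr_eq0 -qA addNr sublinear0.
split=> // c x; have [c0|c0] := leP 0 c; first exact: qZ.
have -> : c%:C *: x = - ((- c)%:C *: x) by rewrite raddfN /= scaleNr opprK.
by rewrite qN qZ ?oppr_ge0 1?ltW// mulNr opprK.
Qed.

(** * Cutting a sublinear functional along a cone *)

Section Cut.
Variables (p q : V -> R) (C : set V).
Hypotheses (sq : sublinear q) (cC : convex_cone C) (qC : additive_on C q).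

(** Subadditivity at [x + s] and [- x]. The infimum in [cut] is therefore a true one and not a
    default value. *)
Lemma cut_lbound x : lbound [set q (x + s) - q s | s in C] (- q (- x)).
Proof.
move=> _ [s _ <-]; have [qD _] := sq.
by have := qD (x + s) (- x); rewrite addrAC subrr add0r; lra.
Qed.

Lemma cut_le x s : C s -> cut q C x <= q (x + s) - q s.
Proof.
move=> Cs; apply: ge_inf; last by exists s.
by exists (- q (- x)); exact: cut_lbound.
Qed.

Lemma le_cut x r : (forall s, C s -> r <= q (x + s) - q s) -> r <= cut q C x.
Proof.
have [C0 _ _] := cC; move=> rq; apply: lb_le_inf; first by exists (q (x + 0) - q 0); exists 0.
by move=> _ [s Cs <-]; exact: rq.
Qed.

Lemma cut_le_id x : cut q C x <= q x.
Proof.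
have [C0 _ _] := cC.
by rewrite (le_trans (cut_le x C0))// addr0 sublinear0// subr0.
Qed.

Lemma cutN s : C s -> cut q C (- s) <= - q s.
Proof.
by move=> Cs; rewrite (le_trans (cut_le _ Cs))// addNr sublinear0// sub0r.
Qed.

Lemma cut_sublinear : sublinear (cut q C).
Proof.
have [C0 CD CZ] := cC; have [qD qZ] := sq.
have cutD x y : cut q C (x + y) <= cut q C x + cut q C y.
  rewrite -lerBlDr; apply: le_cut => s Cs; rewrite lerBlDr -lerBlDl.
  apply: le_cut => s' Cs'; rewrite lerBlDr.
  (* Additivity on [C] splits [q (s + s')], so [s + s'] serves as the competitor for [x + y]. *)
  rewrite (le_trans (cut_le _ (CD _ _ Cs Cs')))// (qC Cs Cs') addrACA.
  by have := qD (x + s) (y + s'); lra.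
have cutZ c x : 0 < c -> c * cut q C x <= cut q C (c%:C *: x).
  move=> c0; apply: le_cut => s Cs; rewrite mulrC -ler_pdivlMr// mulrC.
  have ci0 : 0 <= c^-1 by rewrite invr_ge0 ltW.
  rewrite mulrBr -!qZ// scalerDr scalerA -rmorphM /= mulVf ?gt_eqF// scale1r.
  by apply: cut_le; exact: CZ.
split=> // c x; rewrite le_eqVlt => /predU1P[<-|c0].
  rewrite mul0r scale0r; apply/eqP; rewrite eq_le; apply/andP; split.
    by rewrite (le_trans (cut_le_id 0))// sublinear0.
  by apply: le_cut => s _; rewrite add0r subrr.
apply/eqP; rewrite eq_le cutZ// andbT.
have ci0 : 0 < c^-1 by rewrite invr_gt0.
(* The reverse inequality is the same one for the factor [c^-1]. *)
have := cutZ c^-1 (c%:C *: x) ci0.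
rewrite scalerA -rmorphM /= mulVf ?gt_eqF// scale1r.
by rewrite mulrC ler_pdivrMr// mulrC.
Qed.

Lemma real_linear_le_cut u : real_linear u -> (forall x, u x <= q x) ->
  (forall s, C s -> q s <= u s) -> forall x, u x <= cut q C x.
Proof.
move=> [uD _] uq uC x; apply: le_cut => s Cs; rewrite lerBrDr.
by rewrite (le_trans _ (uq _))// uD lerD2l uC.
Qed.

(** Agreeing with [q] on [C] is a face condition: at [- s] the combination is at most [- q s], so
    the average of [u1 s] and [u2 s] reaches [q s], which bounds both of them; hence both equal
    it. *)
Lemma cut_facial : (forall x, q x <= p x) -> facial p q -> facial p (cut q C).
Proof.
move=> qp fq t u1 u2 t01 l1 l2 u1p u2p uq.
have [u1q u2q] : (forall x, u1 x <= q x) /\ (forall x, u2 x <= q x).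
  by apply: (fq t) => // x; rewrite (le_trans (uq x))// cut_le_id.
have uN u s : real_linear u -> u (- s) = - u s.
  move=> [uD uZ]; have := uZ (-1) s.
  by rewrite raddfN /= scaleN1r mulN1r.
have uC s : C s -> q s <= u1 s /\ q s <= u2 s.
  move=> Cs; have := le_trans (uq (- s)) (cutN Cs).
  rewrite !uN//; have := u1q s; have := u2q s; have /andP[t0 t1] := t01.
  by split; nra.
by split; apply: real_linear_le_cut => // s /uC[].
Qed.

End Cut.

(** Zorn's lemma for the reversed pointwise order. A nonempty chain is bounded by its pointwise
    infimum, which is finite because every member is at least [- q0 (- x)] at [x]. *)
Lemma minimal_facial p q0 : sublinear q0 -> (forall x, q0 x <= p x) ->
  facial p q0 ->
  exists q, [/\ sublinear q, forall x, q x <= q0 x, facial p q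
    & forall q', sublinear q' -> facial p q' -> (forall x, q' x <= q x) ->
      q' = q].
Proof.
move=> sq0 q0p fq0.
pose T := {q | [/\ sublinear q, forall x, q x <= q0 x & facial p q]}.
pose r (a b : T) := `[< forall x, sval b x <= sval a x >].
have t0 : T by exists q0.
have [||a b /asboolP ab /asboolP ba|A totA|[q [sq qq0 fq]] qmin] := @Zorn T r.
- by move=> a; apply/asboolP.
- move=> a b c /asboolP ab /asboolP bc; apply/asboolP => x.
  exact: le_trans (bc x) (ab x).
- case: a b ab ba => [a Pa] [b Pb] /= ab ba.
  apply: eq_exist; apply/funext => x.
  by apply/eqP; rewrite eq_le ab ba.
- have [[a0 Aa0]|A0] := pselect (exists a, A a); last first.
    by exists t0 => s As; exfalso; apply: A0; exists s.
  pose E x := [set sval a x | a in A].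
  have lbE x : lbound (E x) (- q0 (- x)).
    move=> _ [[a [sa aq0 fa]] Aa <-] /=.
    by rewrite (le_trans _ (sublinearN x sa))// lerN2.
  pose q x := inf (E x).
  have qle x a : A a -> q x <= sval a x.
    move=> Aa; apply: ge_inf; last by exists a.
    by exists (- q0 (- x)); exact: lbE.
  have le_q x c : (forall a, A a -> c <= sval a x) -> c <= q x.
    move=> cA; apply: lb_le_inf; first by exists (sval a0 x), a0.
    by move=> _ [a Aa <-]; exact: cA.
  have sq : sublinear q.
    split=> [x y|c x].
      rewrite -lerBlDr; apply: (le_q _ _) => a Aa; rewrite lerBlDr -lerBlDl.
      apply: (le_q _ _) => b Ab; rewrite lerBlDr.
      (* The smaller of the two chain members bounds the infimum at [x + y]. *)
      have [/asboolP ab|/asboolP ba] := totA _ _ Aa Ab.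
        rewrite (le_trans (qle _ _ Ab))//; have [[bD _] _ _] := svalP b.
        by rewrite (le_trans (bD _ _))// addrC lerD2l ab.
      rewrite (le_trans (qle _ _ Aa))//; have [[aD _] _ _] := svalP a.
      by rewrite (le_trans (aD _ _))// addrC lerD2r ba.
    rewrite le_eqVlt => /predU1P[<-|c0].
      rewrite mul0r scale0r; apply/eqP; rewrite eq_le; apply/andP; split.
        rewrite (le_trans (qle _ _ Aa0))//; have [sa _ _] := svalP a0.
        by rewrite sublinear0.
      by apply: (le_q _ _) => a Aa; have [sa _ _] := svalP a; rewrite sublinear0.
    apply/eqP; rewrite eq_le; apply/andP; split.
      rewrite [leRHS]mulrC -ler_pdivrMr//; apply: (le_q _ _) => a Aa.
      rewrite ler_pdivrMr// (le_trans (qle _ _ Aa))//.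
      by have [[_ aZ] _ _] := svalP a; rewrite (aZ _ _ (ltW c0)) mulrC.
    apply: (le_q _ _) => a Aa; have [[_ aZ] _ _] := svalP a.
    by rewrite (aZ _ _ (ltW c0)) ler_pM2l// qle.
  have qq0 x : q x <= q0 x.
    by have [_ a0q _] := svalP a0; rewrite (le_trans (qle _ _ Aa0)) ?a0q.
  have fq : facial p q.
    move=> t u1 u2 t01 l1 l2 u1p u2p uq.
    have H a : A a -> (forall x, u1 x <= sval a x) /\ (forall x, u2 x <= sval a x).
      move=> Aa; have [_ _ fa] := svalP a; apply: (fa t) => // x.
      by rewrite (le_trans (uq x))// qle.
    by split=> x; apply: (le_q _ _) => a /H[].
  by exists (exist _ q (And3 sq qq0 fq)) => a Aa; apply/asboolP => x /=; exact: qle.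
- exists q; split=> // q' sq' fq' q'q.
  have q'q0 x : q' x <= q0 x by exact: le_trans (q'q x) (qq0 x).
  have rq : r (exist _ q (And3 sq qq0 fq)) (exist _ q' (And3 sq' q'q0 fq')).
    exact/asboolP.
  by have [] := qmin _ rq.
Qed.

(* Cutting a minimal [q] along the ray of [s] leaves it unchanged, which says
   that [q] is additive against [s]. *)
Lemma extreme_linear p C : sublinear p -> convex_cone C -> additive_on C p ->
  exists u, [/\ real_linear u, forall x, u x <= p x, facial p u
    & forall s, C s -> u s = p s].
Proof.
move=> sp cC pC.
have fp : facial p p by [].
have sq0 := cut_sublinear sp cC pC.
have q0p := cut_le_id sp cC.
have [q [sq qq0 fq qmin]] :=
  minimal_facial sq0 q0p (cut_facial sp cC (fun x => lexx _) fp).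
have qp x : q x <= p x by exact: le_trans (qq0 x) (q0p x).
have lq : real_linear q.
  apply: sublinear_additive_linear => // x s.
  pose D := [set c%:C *: s | c in [set c : R | 0 <= c]].
  have [qD qZ] := sq.
  have cD : convex_cone D.
    split; first by exists 0; rewrite /= ?lexx// scale0r.
      move=> _ _ [a /= a0 <-] [b /= b0 <-]; exists (a + b); rewrite /= ?addr_ge0//.
      by rewrite rmorphD /= scalerDl.
    move=> c _ c0 [a /= a0 <-]; exists (c * a); rewrite /= ?mulr_ge0//.
    by rewrite rmorphM /= scalerA.
  have qDa : additive_on D q.
    move=> _ _ [a /= a0 <-] [b /= b0 <-].
    by rewrite -scalerDl -rmorphD /= !qZ ?addr_ge0// mulrDl.
  have Ds : D s by exists 1; rewrite /= ?ler01// scale1r.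
  have cutq : cut q D = q.
    apply: qmin; first exact: cut_sublinear.
      exact: cut_facial.
    exact: cut_le_id.
  by rewrite -lerBrDr -{1}cutq; exact: cut_le.
(* The initial cut gives [q (- s) <= - p s]; by linearity this is the missing bound [p s <= q s]. *)
exists q; split=> // s Cs; apply/eqP; rewrite eq_le qp/=.
have [_ qZ] := lq; have := qZ (-1) s.
rewrite raddfN /= scaleN1r mulN1r => qN.
by have := le_trans (qq0 (- s)) (cutN sp Cs); rewrite qN lerN2.
Qed.

End SublinearExtreme.

(** * Geometry of ell2 *)

Section HilbertSpace.
Variable R : realType.
Notation H := (ell2 R).
Implicit Types x y z : H.

Lemma sqr_normcE (a : R[i]) : normc a ^+ 2 = complex.Re a ^+ 2 + complex.Im a ^+ 2.
Proof. by case: a => a1 a2 /=; rewrite sqr_sqrtr ?addr_ge0 ?sqr_ge0. Qed.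

Lemma normc_ge0 (a : R[i]) : 0 <= normc a.
Proof. by case: a => ? ?; exact: sqrtr_ge0. Qed.

Lemma ell2D x y i : (x + y) i = x i + y i. Proof. by []. Qed.

Lemma ell2Z a x i : (a *: x) i = a * x i. Proof. by []. Qed.

Lemma ell2_ext x y : (forall i, x i = y i) -> x = y.
Proof. by move=> xy; apply/val_inj/funext. Qed.

Lemma bounded_sqr_summable (v : nat -> R[i]^o) (M : R) :
  (forall n, \sum_(i < n) normc (v i) ^+ 2 <= M) -> v \in @square_summable R.
Proof.
move=> vM; apply/square_summableP; apply: nondecreasing_is_cvgn.
  by apply: nondecreasing_series => n _ _; exact: sqr_ge0.
by exists M => _ [n _ <-]; rewrite /sqr_series seriesEord; exact: vM.
Qed.

Lemma sqr_norm2_le x (M : R) :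
  (forall n, \sum_(i < n) normc (x i) ^+ 2 <= M) -> norm2 x ^+ 2 <= M.
Proof.
move=> xM; rewrite sqr_norm2; apply: limr_le; first exact: ell2_cvg.
by apply: nearW => n; rewrite /sqr_series seriesEord; exact: xM.
Qed.

Lemma sum_ord_le_sqr_norm2 x n : \sum_(i < n) normc (x i) ^+ 2 <= norm2 x ^+ 2.
Proof.
have nd : nondecreasing_seq (sqr_series x).
  by apply: nondecreasing_series => k _ _; exact: sqr_ge0.
have := nondecreasing_cvgn_le nd (@ell2_cvg _ x) n.
by rewrite sqr_norm2 {1}/sqr_series seriesEord.
Qed.

Lemma sum_uniq_le_sqr_norm2 x (s : seq nat) : uniq s ->
  \sum_(i <- s) normc (x i) ^+ 2 <= norm2 x ^+ 2.
Proof.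
move=> us; pose n := (\max_(i <- s) i).+1.
apply: le_trans (sum_ord_le_sqr_norm2 x n).
rewrite -(big_mkord predT (fun i => normc (x i) ^+ 2)).
rewrite [leRHS](bigID [pred i | i \in s]) /= -[leLHS]addr0 lerD//; last first.
  by apply: sumr_ge0 => i _; exact: sqr_ge0.
rewrite -[leRHS]big_filter le_eqVlt; apply/orP; left; apply/eqP/perm_big.
apply: uniq_perm => //; first by rewrite filter_uniq// iota_uniq.
move=> i; rewrite mem_filter mem_index_iota /=.
have [si|//] := boolP (i \in s); rewrite /= /n ltnS.
by apply/esym; exact: leq_bigmax_seq.
Qed.

Let prod x y n : R[i] := x n * (y n)^*.

Lemma cvg_series_le_sqr x y (f : R^nat) :
  (forall n, `|f n| <= normc (x n) ^+ 2 + normc (y n) ^+ 2) ->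
  cvgn (series f).
Proof.
move=> fxy; apply: normed_cvg.
apply: series_le_cvg (is_cvg_seriesD (@ell2_cvg _ x) (@ell2_cvg _ y)) => n //=.
by rewrite addr_ge0// sqr_ge0.
Qed.

Lemma cvg_Re_prod x y : cvgn (series (fun n => complex.Re (prod x y n))).
Proof.
apply: (@cvg_series_le_sqr x y) => n; rewrite !sqr_normcE /prod.
case: (x n) (y n) => [a b] [c d] /=; rewrite ler_norml.
have := sqr_ge0 (a - c); have := sqr_ge0 (a + c).
by have := sqr_ge0 (b - d); have := sqr_ge0 (b + d); nra.
Qed.

Lemma cvg_Im_prod x y : cvgn (series (fun n => complex.Im (prod x y n))).
Proof.
apply: (@cvg_series_le_sqr x y) => n; rewrite !sqr_normcE /prod.
case: (x n) (y n) => [a b] [c d] /=; rewrite ler_norml.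
have := sqr_ge0 (a - d); have := sqr_ge0 (a + d).
by have := sqr_ge0 (b - c); have := sqr_ge0 (b + c); nra.
Qed.

Lemma lim_series_comb (a b : R) (f g : R^nat) :
  cvgn (series f) -> cvgn (series g) ->
  limn (series (fun n => a * f n + b * g n)) =
  a * limn (series f) + b * limn (series g).
Proof.
move=> cf cg; have caf := @is_cvg_seriesZ _ _ a cf.
have cbg := @is_cvg_seriesZ _ _ b cg.
by rewrite -[a * _](@lim_seriesZ _ _ a cf) -[b * _](@lim_seriesZ _ _ b cg) -lim_seriesD.
Qed.

Lemma innerDl x y z : inner (x + y) z = inner x z + inner y z.
Proof.
have lim1 (f g h : R^nat) : (forall n, h n = f n + g n) ->
    cvgn (series f) -> cvgn (series g) ->
    limn (series h) = limn (series f) + limn (series g).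
  move=> hfg cf cg; rewrite -lim_seriesD//; congr (limn (series _)).
  exact/funext.
rewrite /inner; apply/eqP; rewrite eq_complex /=; apply/andP; split; apply/eqP.
- apply: lim1; [|exact: cvg_Re_prod|exact: cvg_Re_prod].
  by move=> n; rewrite -raddfD -mulrDl.
- apply: lim1; [|exact: cvg_Im_prod|exact: cvg_Im_prod].
  by move=> n; rewrite -raddfD -mulrDl.
Qed.

Lemma innerZl (a : R[i]) x y : inner (a *: x) y = a * inner x y.
Proof.
have cr := @cvg_Re_prod x y; have ci := @cvg_Im_prod x y.
case: a => a1 a2; rewrite /inner.
apply/eqP; rewrite eq_complex /= -mulNr; apply/andP; split; apply/eqP.
- rewrite -lim_series_comb//; congr (limn (series _)); apply/funext => n.
  rewrite -[(_ *: _) n]/((a1 +i* a2) * x n).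
  by case: (x n) (y n) => [b c] [d e] /=; ring.
- rewrite -lim_series_comb//; congr (limn (series _)); apply/funext => n.
  rewrite -[(_ *: _) n]/((a1 +i* a2) * x n).
  by case: (x n) (y n) => [b c] [d e] /=; ring.
Qed.

Lemma inner_conj x y : inner y x = conjc (inner x y).
Proof.
rewrite /inner; apply/eqP; rewrite eq_complex /=; apply/andP; split; apply/eqP.
- congr (limn (series _)); apply/funext => n.
  by case: (x n) (y n) => [b c] [d e] /=; ring.
- have ci := @cvg_Im_prod x y; rewrite -lim_seriesN//.
  congr (limn (series _)); apply/funext => n.
  by rewrite fctE /prod; case: (x n) (y n) => [b c] [d e] /=; ring.
Qed.

Lemma inner_diag x : inner x x = (norm2 x ^+ 2)%:C.
Proof.
rewrite sqr_norm2 /inner; apply/eqP; rewrite eq_complex /=.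
apply/andP; split; apply/eqP.
- congr (limn (series _)); apply/funext => n; rewrite sqr_normcE.
  by case: (x n) => [b c] /=; ring.
- rewrite (_ : (fun n => _) = (fun=> 0)); last first.
    by apply/funext => n; case: (x n) => [b c] /=; ring.
  rewrite (_ : series _ = (fun=> 0)); first exact: lim_cst.
  by apply/funext => n; rewrite /series /= big1_eq.
Qed.

Lemma conjcM (a b : R[i]) : conjc (a * b) = conjc a * conjc b.
Proof. exact: rmorphM. Qed.

Lemma conjcD (a b : R[i]) : conjc (a + b) = conjc a + conjc b.
Proof. exact: rmorphD. Qed.

Lemma innerZr (a : R[i]) x y : inner x (a *: y) = conjc a * inner x y.
Proof. by rewrite inner_conj innerZl conjcM -inner_conj. Qed.

Lemma innerDr x y z : inner x (y + z) = inner x y + inner x z.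
Proof. by rewrite inner_conj innerDl conjcD -!inner_conj. Qed.

Lemma inner0l x : inner 0 x = 0.
Proof. by rewrite -(scale0r (0 : H)) innerZl mul0r. Qed.

Lemma inner_suml (I : Type) (r : seq I) (f : I -> H) x :
  inner (\sum_(i <- r) f i) x = \sum_(i <- r) inner (f i) x.
Proof.
elim: r => [|i r IH]; first by rewrite !big_nil inner0l.
by rewrite !big_cons innerDl IH.
Qed.

Lemma sqr_norm2D x y :
  norm2 (x + y) ^+ 2 = norm2 x ^+ 2 + 2 * complex.Re (inner x y) + norm2 y ^+ 2.
Proof.
have E z : norm2 z ^+ 2 = complex.Re (inner z z) by rewrite inner_diag.
rewrite !E innerDl !innerDr (inner_conj x y).
by case: (inner x x) (inner x y) (inner y y) => [a b] [c d] [e f] /=; ring.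
Qed.

Lemma normc_realC (r : R) : normc r%:C = `|r|.
Proof. by rewrite /= expr0n /= addr0 sqrtr_sqr. Qed.

(** Cauchy-Schwarz, from the nonnegativity of the squared norm of [x + t y] as a quadratic in real
    [t]. *)
Lemma Re_inner_le x y : complex.Re (inner x y) <= norm2 x * norm2 y.
Proof.
have H t : 0 <= norm2 x ^+ 2 + 2 * (t * complex.Re (inner x y)) + (t * norm2 y) ^+ 2.
  have := sqr_ge0 (norm2 (x + t%:C *: y)).
  rewrite sqr_norm2D innerZr norm2Z normc_realC exprMn real_normK ?num_real// -exprMn.
  by case: (inner x y) => a b /=; rewrite oppr0 !mul0r subr0.
have a0 := norm2_ge0 x; have b0 := norm2_ge0 y.
move: (complex.Re _) (norm2 x) (norm2 y) a0 b0 H => r a b a0 b0 H.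
have [r0|r0] := leP r 0; first by rewrite (le_trans r0)// mulr_ge0.
move: b0; rewrite le_eqVlt => /predU1P[b0|b0].
  (* For [b = 0] the quadratic is affine in [t], and this [t] gives it the value [- a ^+ 2 - 2]. *)
  have := H (- (a ^+ 2 + 1) / r); rewrite -b0 mulr0 expr0n addr0 -mulrA.
  by rewrite mulVf ?gt_eqF// mulr1; have := sqr_ge0 a; lra.
(* The minimizer of the quadratic. *)
have := H (- r / b ^+ 2).
have -> : a ^+ 2 + 2 * (- r / b ^+ 2 * r) + (- r / b ^+ 2 * b) ^+ 2 =
    a ^+ 2 - (r / b) ^+ 2 by field; rewrite gt_eqF.
rewrite subr_ge0 => rb.
by rewrite -ler_pdivrMr// -(@ler_pXn2r _ 2)// nnegrE// divr_ge0// ltW.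
Qed.

(** The subadditivity of the operator norm requires the constant 1 in place of the factor 2 of
    [norm2D_le]. *)
Lemma norm2D x y : norm2 (x + y) <= norm2 x + norm2 y.
Proof.
rewrite -(@ler_pXn2r _ 2) ?nnegrE ?addr_ge0 ?norm2_ge0// sqr_norm2D sqrrD.
by rewrite lerD2r lerD2l -[leRHS]mulr_natl ler_pM2l// Re_inner_le.
Qed.

Lemma norm2_ortho_unit x : inner x x = 1 -> norm2 x = 1.
Proof.
rewrite inner_diag => /(congr1 (@complex.Re R)) /= /eqP.
by rewrite sqrf_eq1 => /orP[/eqP//|/eqP x1]; have := norm2_ge0 x; rewrite x1; lra.
Qed.

Lemma ell2_sum (I : Type) (r : seq I) (f : I -> H) i :
  (\sum_(k <- r) f k) i = \sum_(k <- r) f k i.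
Proof. by elim: r => [|k r IH]; rewrite ?big_nil// !big_cons ell2D IH. Qed.

Lemma mul_conj_normc (a : R[i]) : conjc a * a = (normc a ^+ 2)%:C.
Proof.
rewrite sqr_normcE; case: a => a b /=; apply/eqP; rewrite eq_complex /=.
by apply/andP; split; apply/eqP; ring.
Qed.

(* Bessel's inequality for the [i]-th vector of the standard basis. *)
Lemma orthonormal_coord_le1 (e : nat -> H) i (K : nat) :
  (forall k l, inner (e k) (e l) = (k == l)%:R) ->
  \sum_(k < K) normc (e k i) ^+ 2 <= 1.
Proof.
move=> eo; set s := \sum_(k < K) _.
(* The projection of the [i]-th standard vector onto the span of the first [K] vectors [e k]. Its
   [i]-th coordinate and its squared norm are both [s], so [s ^+ 2 <= s]. *)
pose v : H := \sum_(k < K) conjc (e k i) *: e k.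
have inv (k : 'I_K) : inner (e k) v = e k i.
  rewrite inner_conj inner_suml (bigD1 k)//= big1 ?addr0 => [|l lk].
    by rewrite innerZl eo eqxx mulr1 conjcK.
  by rewrite innerZl eo (negPf (lk : nat_of_ord l != k)) mulr0.
have vE : v i = s%:C.
  rewrite ell2_sum rmorph_sum; apply: eq_bigr => k _.
  by rewrite ell2Z mul_conj_normc.
have nv : norm2 v ^+ 2 = s.
  apply: complexI; rewrite -inner_diag inner_suml rmorph_sum /=.
  by apply: eq_bigr => k _; rewrite innerZl inv mul_conj_normc.
have := @sum_uniq_le_sqr_norm2 v [:: i] isT.
rewrite big_seq1 vE normc_realC nv real_normK ?num_real//.
have s0 : 0 <= s by apply: sumr_ge0 => k _; exact: sqr_ge0.
by nra.
Qed.

End HilbertSpace.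

(** * Tensor powers of rank one projections *)

Section TensorPower.
Variables (R : realType) (X : finType).

(** The power [X^n] as iterated pairs, so that the first tensor factor splits off by computation. *)
Fixpoint cube (n : nat) : finType :=
  if n is m.+1 then (X * cube m)%type : finType else unit : finType.

Definition energy (T : finType) (b : T -> R) : R := \sum_t b t ^+ 2.

Definition slice n (x : X) (b : cube n.+1 -> R) : cube n -> R :=
  fun y => b (x, y).

Definition contract n (w : X -> R) (b : cube n.+1 -> R) : cube n -> R :=
  fun y => \sum_x w x * b (x, y).

(* The [n]-th tensor power of the projection onto the complement of the unit
   vector [w]. *)
Fixpoint compl_power (w : X -> R) (n : nat) : (cube n -> R) -> cube n -> R :=
  if n is m.+1 then fun b t =>
    compl_power w (slice t.1 b) t.2 - w t.1 * compl_power w (contract w b) t.2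
  else fun b => b.

(** For a unit vector [w] this is the squared norm of the image of [b] under
    [1 - (1 - w w^T)^{(x) n}]; see [capturedE]. *)
Definition captured (w : X -> R) n (b : cube n -> R) : R :=
  energy b - energy (compl_power w b).

Lemma energy_ge0 (T : finType) (b : T -> R) : 0 <= energy b.
Proof. by apply: sumr_ge0 => t _; exact: sqr_ge0. Qed.

Lemma sum_cubeS n (F : cube n.+1 -> R) :
  \sum_t F t = \sum_x \sum_y F (x, y).
Proof. by rewrite pair_big /=; apply: eq_bigr => -[]. Qed.

Lemma energyS n (b : cube n.+1 -> R) : energy b = \sum_x energy (slice x b).
Proof. exact: sum_cubeS. Qed.

(** Arbitrary finite combinations are allowed because [contract] is one: it combines the slices of
    [b] with weights [w x]. *)
Lemma compl_power_lin (I : finType) w n (a : I -> R) (g : I -> cube n -> R) t :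
  compl_power w (fun y => \sum_i a i * g i y) t = \sum_i a i * compl_power w (g i) t.
Proof.
elim: n g t => [//|n IH] g [x y] /=.
rewrite /slice IH.
rewrite (_ : contract _ _ = fun y => \sum_i a i * contract w (g i) y); last first.
  apply/funext => z; rewrite /contract.
  under eq_bigr do rewrite mulr_sumr.
  rewrite exchange_big /=; apply: eq_bigr => i _; rewrite mulr_sumr.
  by apply: eq_bigr => j _; rewrite mulrCA.
rewrite IH mulr_sumr -sumrB; apply: eq_bigr => i _.
by rewrite mulrBr (mulrCA (w x)).
Qed.

Lemma compl_powerZ w n (a : R) (b : cube n -> R) t :
  compl_power w (fun y => a * b y) t = a * compl_power w b t.
Proof.
have := compl_power_lin w (fun _ : 'I_1 => a) (fun _ : 'I_1 => b) t.
rewrite big_ord1 => <-; congr (compl_power w _ t).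
by apply/funext => y; rewrite big_ord1.
Qed.

Lemma compl_power_contract w n (b : cube n.+1 -> R) t :
  compl_power w (contract w b) t = \sum_x w x * compl_power w (slice x b) t.
Proof. exact: compl_power_lin. Qed.

Section Projection.
Variable w : X -> R.
Hypothesis w1 : energy w = 1.

Lemma energy_residual (f : X -> R) :
  energy (fun x => f x - w x * \sum_z w z * f z) =
  energy f - (\sum_z w z * f z) ^+ 2.
Proof.
set c := \sum_z _.
transitivity (energy f + \sum_x (- 2 * c) * (w x * f x) + c ^+ 2 * energy w).
  rewrite /energy mulr_sumr -!big_split /=; apply: eq_bigr => x _.
  by ring.
by rewrite w1 -mulr_sumr -/c; ring.
Qed.

(** Pythagoras in the first tensor factor ([energy_residual]), applied at each point of the
    remaining factors. *)
Lemma energy_compl_powerS n (b : cube n.+1 -> R) :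
  energy (compl_power w b) =
  \sum_x energy (compl_power w (slice x b)) -
  energy (compl_power w (contract w b)).
Proof.
rewrite energyS /energy exchange_big [in RHS]exchange_big -sumrB /=.
apply: eq_bigr => y _; rewrite compl_power_contract -energy_residual.
by apply: eq_bigr => x _; rewrite /slice /= compl_power_contract.
Qed.

(** This is how [compl_power w] is known to be an orthogonal projection. Both sides obey the
    recursion of [energy_compl_powerS]. *)
Lemma compl_power_projection n (b : cube n -> R) :
  \sum_t compl_power w b t * b t = energy (compl_power w b).
Proof.
elim: n b => [|n IH] b; first by apply: eq_bigr => t _; rewrite expr2.
have E1 : \sum_t compl_power w b t * b t =
    \sum_x energy (compl_power w (slice x b)) -
    energy (compl_power w (contract w b)).
  rewrite sum_cubeS /= -(IH (contract w b)).
  under eq_bigr do under eq_bigr do rewrite mulrBl.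
  under eq_bigr do rewrite sumrB.
  rewrite sumrB; congr (_ - _); first by apply: eq_bigr => x _; exact: IH.
  rewrite exchange_big /=; apply: eq_bigr => y _.
  by rewrite mulr_sumr; apply: eq_bigr => x _; ring.
by rewrite E1 energy_compl_powerS.
Qed.

Lemma capturedE n (b : cube n -> R) :
  captured w b = energy (fun t => b t - compl_power w b t).
Proof.
rewrite /captured.
transitivity (energy b + \sum_t (- 2) * (compl_power w b t * b t) +
              energy (compl_power w b)).
  by rewrite -mulr_sumr compl_power_projection; ring.
by rewrite /energy -!big_split /=; apply: eq_bigr => t _; ring.
Qed.

Lemma captured_ge0 n (b : cube n -> R) : 0 <= captured w b.
Proof. by rewrite capturedE energy_ge0. Qed.

Lemma captured_le n (b : cube n -> R) : captured w b <= energy b.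
Proof. by rewrite lerBlDr lerDl energy_ge0. Qed.

(** A union bound: what is captured is captured by the last [n] factors or by the first one. The
    discarded term is [captured w (contract w b)]. *)
Lemma capturedS n (b : cube n.+1 -> R) :
  captured w b <= \sum_x captured w (slice x b) + energy (contract w b).
Proof.
rewrite /captured energy_compl_powerS energyS sumrB.
by have := captured_ge0 (contract w b); rewrite /captured; lra.
Qed.

End Projection.

(** * Nearly orthogonal families *)

Section Family.
Variables (J : finType) (w : J -> X -> R) (mu : R).
Hypothesis mu0 : 0 <= mu.
Hypothesis w1 : forall j, energy (w j) = 1.
Hypothesis wmu : forall i j, i != j -> `|\sum_x w i x * w j x| <= mu.
Variable S : {set J}.

(** Let [s] be the sum of the [a j * w j]. Then the left side [t] is the inner product of [s] and
    [v], and near orthogonality gives [energy s <= c * t] with [c = 1 + #|S|%:R * mu]. Expanding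
    [energy (s - c v) >= 0] yields [t <= c * energy v]. *)
Lemma almost_bessel (v : X -> R) :
  \sum_(j in S) (\sum_x w j x * v x) ^+ 2 <= (1 + #|S|%:R * mu) * energy v.
Proof.
pose a j := \sum_x w j x * v x.
pose s x := \sum_(j in S) a j * w j x.
have sv : \sum_x s x * v x = \sum_(j in S) a j ^+ 2.
  rewrite /s; under eq_bigr do rewrite mulr_suml.
  rewrite exchange_big /=; apply: eq_bigr => j _.
  rewrite expr2 {2}/a mulr_sumr.
  by apply: eq_bigr => x _; rewrite mulrA.
set t := \sum_(j in S) a j ^+ 2 in sv *.
have ss : energy s <= (1 + #|S|%:R * mu) * t.
  have -> : energy s = \sum_(i in S) \sum_(j in S) a i * a j * \sum_x w i x * w j x.
    rewrite /energy; under eq_bigr do rewrite expr2 big_distrlr /=.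
    rewrite exchange_big /=; apply: eq_bigr => i _.
    rewrite exchange_big /=; apply: eq_bigr => j _.
    by rewrite mulr_sumr; apply: eq_bigr => x _; ring.
  (* The right side is spread over the pairs [(i, j)] so that the off-diagonal terms compare by the
     arithmetic-geometric mean inequality. *)
  have -> : (1 + #|S|%:R * mu) * t =
      \sum_(i in S) \sum_(j in S)
        ((i == j)%:R * a i ^+ 2 + mu / 2 * a i ^+ 2 + mu / 2 * a j ^+ 2).
    under eq_bigr do rewrite !big_split /=.
    rewrite !big_split /= mulrDl mul1r -addrA; congr (_ + _).
      apply: eq_bigr => i iS; rewrite (bigD1 i)//= eqxx mul1r big1 ?addr0//.
      by move=> j /andP[_ ji]; rewrite eq_sym (negPf ji) mul0r.
    under eq_bigr do rewrite sumr_const -[_ *+ #|_|]mulr_natr.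
    rewrite -mulr_suml -mulr_sumr -/t sumr_const.
    by rewrite -[_ * t *+ #|S|]mulr_natr; field.
  apply: ler_sum => i iS; apply: ler_sum => j jS.
  have [<-|ij] := eqVneq i j.
    rewrite (_ : \sum_x _ = 1) ?mulr1 ?mul1r ?eqxx; last first.
      by rewrite -(w1 i); apply: eq_bigr => x _; rewrite expr2.
    by have := mulr_ge0 mu0 (sqr_ge0 (a i)); lra.
  rewrite mul0r add0r; have := wmu ij; rewrite ler_norml => /andP[].
  move: (\sum_x _) => c; have := sqr_ge0 (a i - a j).
  have := sqr_ge0 (a i + a j); nra.
have tE : t = \sum_x s x * v x by rewrite sv.
have t0 : 0 <= t by apply: sumr_ge0 => j _; exact: sqr_ge0.
set c := 1 + _ in ss *.
have c0 : 0 < c by rewrite ltr_pwDl// mulr_ge0.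
have : 0 <= energy s - 2 * c * \sum_x s x * v x + c ^+ 2 * energy v.
  suff -> : energy s - 2 * c * \sum_x s x * v x + c ^+ 2 * energy v =
      energy (fun x => s x - c * v x) by exact: energy_ge0.
  rewrite /energy -mulNr !mulr_sumr -!big_split /=.
  by apply: eq_bigr => x _; ring.
rewrite -tE => E0.
have : 0 <= c * (c * energy v - t) by lra.
by rewrite pmulr_rge0// subr_ge0.
Qed.

(** By [capturedS], each tensor factor costs one application of [almost_bessel]. *)
Lemma sum_captured n (b : cube n -> R) :
  \sum_(j in S) captured (w j) b <= n%:R * (1 + #|S|%:R * mu) * energy b.
Proof.
elim: n b => [|n IH] b.
  by rewrite !mul0r big1// => j _; rewrite /captured /= subrr.
have le1 : \sum_(j in S) captured (w j) b <=
    \sum_(j in S) (\sum_x captured (w j) (slice x b) + energy (contract (w j) b)).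
  by apply: ler_sum => j _; exact: capturedS.
apply: (le_trans le1); rewrite big_split /= -natr1 2!mulrDl mul1r lerD//.
  rewrite exchange_big /= energyS mulr_sumr.
  by apply: ler_sum => x _; exact: IH.
rewrite /energy sum_cubeS exchange_big [X in _ * X]exchange_big /= mulr_sumr.
by apply: ler_sum => y _; exact: (almost_bessel (fun x => b (x, y))).
Qed.

End Family.

Section Selection.
Variables (I J : finType) (w : J -> X -> R) (mu : R) (n : nat).
Hypothesis mu0 : 0 <= mu.
Hypothesis w1 : forall j, energy (w j) = 1.
Hypothesis wmu : forall i j, i != j -> `|\sum_x w i x * w j x| <= mu.
Hypothesis nmu : n%:R * mu <= 1 / 2.

(** Sum the defining inequality over the bad set [S] and compare with [sum_captured]. As
    [n%:R * mu <= 1 / 2], the term of order [#|S|] is absorbed by [E / 2]. *)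
Lemma few_capture (b : I -> cube n -> R) (delta : R) :
  #|finset (fun j => (\sum_i energy (b i)) / 2 + delta <
                    \sum_i captured (w j) (b i))|%:R * delta
    <= n%:R * \sum_i energy (b i).
Proof.
set E := \sum_i energy (b i); set S := finset _.
have le1 : \sum_(j in S) (E / 2 + delta) <=
    \sum_(j in S) \sum_i captured (w j) (b i).
  by apply: ler_sum => j; rewrite inE => /ltW.
have le2 : \sum_(j in S) \sum_i captured (w j) (b i) <=
    n%:R * (1 + #|S|%:R * mu) * E.
  rewrite exchange_big /= mulr_sumr; apply: ler_sum => i _.
  exact: sum_captured.
have := le_trans le1 le2; rewrite sumr_const -[_ *+ #|S|]mulr_natl.
have E0 : 0 <= E by apply: sumr_ge0 => i _; exact: energy_ge0.
have SE : 0 <= #|S|%:R * E by rewrite mulr_ge0.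
have := ler_wpM2r SE nmu.
by move: (#|S|%:R) (n%:R) => s m; lra.
Qed.

(** Otherwise every [j] is bad for some [k]. Each bad set is small by [few_capture], and the total
    energy over all [k] is at most the number of points of the cube, so the bad sets cannot cover
    [J]. *)
Lemma exists_uncaptured (b : nat -> I -> cube n -> R) (delta : R) :
  (forall K t, \sum_(k < K) \sum_i b k i t ^+ 2 <= 1) ->
  n%:R * #|cube n|%:R < #|J|%:R * delta ->
  exists j, forall k, \sum_i captured (w j) (b k i) <=
    (\sum_i energy (b k i)) / 2 + delta.
Proof.
move=> b1 Jbig; apply: contrapT => /forallNP nJ.
have /choice[kap kapP] j : exists k, (\sum_i energy (b k i)) / 2 + delta <
    \sum_i captured (w j) (b k i).
  have /existsNP[k /negP] := nJ j; rewrite -ltNge => bk.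
  by exists k.
(* Since [J] is finite, finitely many [k] witness all the failures. *)
pose K := (\max_j kap j).+1.
pose S k := finset (fun j => (\sum_i energy (b k i)) / 2 + delta <
    \sum_i captured (w j) (b k i)).
have JS : (#|J| <= \sum_(k < K) #|S k|)%N.
  apply: (@leq_trans (\sum_(j : J) \sum_(k < K) (j \in S k))).
    rewrite -sum1_card; apply: leq_sum => j _.
    have kK : (kap j < K)%N by rewrite ltnS; exact: leq_bigmax.
    by rewrite (bigD1 (Ordinal kK))//= inE kapP.
  rewrite exchange_big; apply: leq_sum => k _.
  by rewrite -sum1_card [leqRHS]big_mkcond; apply: leq_sum => j _; case: ifP.
have d0 : 0 <= delta.
  rewrite leNgt; apply/negP => d0.
  have : 0 <= n%:R * #|cube n|%:R :> R by rewrite mulr_ge0.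
  by rewrite leNgt (lt_le_trans Jbig)// mulr_ge0_le0// ltW.
move: Jbig; apply/negP; rewrite -leNgt.
apply: (@le_trans _ _ (\sum_(k < K) #|S k|%:R * delta)).
  by rewrite -mulr_suml -natr_sum ler_wpM2r// ler_nat.
apply: (@le_trans _ _ (\sum_(k < K) n%:R * \sum_i energy (b k i))).
  by apply: ler_sum => k _; exact: few_capture.
rewrite -mulr_sumr ler_wpM2l//.
rewrite (eq_bigr (fun k : 'I_K => \sum_t \sum_i b k i t ^+ 2)); last first.
  by move=> k _; rewrite exchange_big.
rewrite exchange_big /= -[leRHS]mulr1 mulr_natl -sumr_const.
by apply: ler_sum => t _; exact: b1.
Qed.

End Selection.

(** The indices decrease: the first coordinate carries the factor of index [n - 1]. *)
Fixpoint tensor (ws : nat -> X -> R) (n : nat) : cube n -> R :=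
  if n is m.+1 then fun t => ws m t.1 * tensor ws t.2 else fun=> 1.

Lemma energy_tensor (ws : nat -> X -> R) n :
  (forall i, energy (ws i) = 1) -> energy (@tensor ws n) = 1.
Proof.
move=> ws1; elim: n => [|n IH].
  rewrite /energy (eq_bigr (fun=> 1)) => [|t _]; last by rewrite /= expr1n.
  by rewrite sumr_const (card_unit : #|cube 0| = 1%N).
rewrite energyS -(ws1 n); apply: eq_bigr => x _.
rewrite -[RHS]mulr1 -IH /energy mulr_sumr; apply: eq_bigr => y _.
by rewrite /slice /= exprMn.
Qed.

(** The factor [1 - w w^T] at the place of [ws i] kills it. There the slice and the contraction
    terms cancel; at the places before it both are multiples of a shorter tensor that is already
    killed. *)
Lemma compl_power_tensor (ws : nat -> X -> R) n i t :
  energy (ws i) = 1 -> (i < n)%N -> compl_power (ws i) (@tensor ws n) t = 0.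
Proof.
move=> wi1; elim: n t => [//|n IH] [x y]; rewrite ltnS leq_eqVlt => /orP[/eqP ni|lt_in] /=.
  subst i.
  rewrite (_ : slice _ _ = fun z => ws n x * tensor ws z)//.
  rewrite (_ : contract _ _ = @tensor ws n) ?compl_powerZ ?subrr//.
  apply/funext => z; rewrite /contract /= -[RHS]mul1r -wi1 /energy mulr_suml.
  by apply: eq_bigr => u _; ring.
rewrite (_ : slice _ _ = fun z => ws n x * tensor ws z)//.
rewrite compl_powerZ IH// mulr0 sub0r.
rewrite (_ : contract _ _ = fun z => (\sum_u ws i u * ws n u) * tensor ws z).
  by rewrite compl_powerZ IH// !mulr0 oppr0.
by apply/funext => z; rewrite /contract mulr_suml; apply: eq_bigr => u _; rewrite mulrA.
Qed.
End TensorPower.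

(** * Graphs of polynomials over a finite field *)

Section GraphFamily.
Variables (R : realType) (q n : nat).
Hypothesis pq : prime q.

Notation X := ('F_q * 'F_q)%type.
Notation J := 'rV['F_q]_(2 * n).+1.

(** A graph has [q] points, whence the normalization. There are [q ^ (2 * n).+1] polynomials, a
    factor [q] more than the dimension [q ^ (2 * n)] of the block. *)
Definition graph_vec (j : J) (x : X) : R :=
  if x.2 == (rVpoly j).[x.1] then (Num.sqrt q%:R)^-1 else 0.

Let q0 : 0 < q%:R :> R. Proof. by rewrite ltr0n prime_gt0. Qed.

Let sqr_sqrtq : (Num.sqrt q%:R)^-1 * (Num.sqrt q%:R)^-1 = q%:R^-1 :> R.
Proof. by rewrite -invfM -expr2 sqr_sqrtr ?ltW. Qed.

Lemma energy_graph_vec j : energy (graph_vec j) = 1.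
Proof.
rewrite /energy; transitivity (\sum_(x : 'F_q) q%:R^-1 : R).
  rewrite -(pair_bigA _ (fun x y => graph_vec j (x, y) ^+ 2)) /=.
  apply: eq_bigr => x _; rewrite (bigD1 (rVpoly j).[x])//= big1 ?addr0.
    by rewrite /graph_vec /= eqxx expr2 sqr_sqrtq.
  by move=> y /negPf yx; rewrite /graph_vec /= yx expr0n.
by rewrite sumr_const card_Fp// -[_ *+ q]mulr_natl mulfV ?gt_eqF.
Qed.

(** Two graphs meet over the roots of a nonzero polynomial of degree at most [2 * n]. *)
Lemma graph_vec_overlap i j : i != j ->
  `|\sum_x graph_vec i x * graph_vec j x| <= (2 * n)%:R / q%:R.
Proof.
move=> ij; pose p := rVpoly i - rVpoly j.
have p0 : p != 0.
  by apply: contra ij; rewrite subr_eq0 => /eqP/(can_inj rVpolyK)/eqP.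
have sp : (size p <= (2 * n).+1)%N.
  by rewrite (leq_trans (size_polyD _ _))// size_polyN geq_max !size_poly.
have -> : \sum_x graph_vec i x * graph_vec j x =
    \sum_(x : 'F_q | root p x) q%:R^-1.
  rewrite -(pair_bigA _ (fun x y => graph_vec i (x, y) * graph_vec j (x, y))) /=.
  rewrite [RHS]big_mkcond; apply: eq_bigr => x _.
  rewrite (bigD1 (rVpoly i).[x])//= big1 ?addr0; last first.
    by move=> y /negPf yx; rewrite /graph_vec /= yx mul0r.
  rewrite /graph_vec /= eqxx rootE hornerD hornerN subr_eq0.
  by case: ifP; rewrite ?sqr_sqrtq ?mulr0.
rewrite sumr_const -[_ *+ _]mulr_natl ger0_norm ?divr_ge0// ler_pM2r ?invr_gt0//.
rewrite ler_nat -ltnS; apply: leq_trans sp; rewrite cardE.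
apply: max_poly_roots => //; last exact: enum_uniq.
by apply/allP => x; rewrite mem_enum.
Qed.

Lemma card_cube_plane : #|cube X n| = (q ^ (2 * n))%N.
Proof.
elim: n => [|m IH]; first by rewrite muln0 expn0 card_unit.
by rewrite card_prod IH card_prod card_Fp// mulnS expnD.
Qed.

(** The bound [4 * n ^ 2 <= q] keeps [n] times the overlap below [1 / 2]; the bound on
    [q%:R * delta] is the counting condition divided by [q ^ (2 * n)]. *)
Lemma exists_uncaptured_graph (I : finType) (b : nat -> I -> cube X n -> R)
    (delta : R) :
  (4 * n ^ 2 <= q)%N -> n%:R < q%:R * delta ->
  (forall K t, \sum_(k < K) \sum_i b k i t ^+ 2 <= 1) ->
  exists j, forall k, \sum_i captured (graph_vec j) (b k i) <=
    (\sum_i energy (b k i)) / 2 + delta.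
Proof.
move=> nq qd b1; apply: (exists_uncaptured _ energy_graph_vec graph_vec_overlap _ b1).
- by rewrite divr_ge0.
- rewrite mulrA ler_pdivrMr//.
  by have := nq; rewrite -(ler_nat R) !natrM; lra.
- rewrite card_cube_plane card_mx card_Fp// mul1n expnS.
  rewrite (mulnC q) natrM mulrC -mulrA ltr_pM2l// ltr0n expn_gt0 prime_gt0//.
Qed.

End GraphFamily.

(** * Block diagonal operators *)

Section BlockOperator.
Variables (R : realType) (Y : nat -> finType).
Notation H := (ell2 R).
Implicit Types x : H.

(** [pickle] is injective but need not be onto: some indices may lie in no block, and block
    operators vanish there. *)
Definition block_code n (y : Y n) : nat :=
  @pickle {n : nat & Y n} (Tagged (fun n => Y n) y).

Definition block_decode (i : nat) : option {n : nat & Y n} := pickle_inv i.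

Lemma block_codeK n (y : Y n) :
  block_decode (block_code y) = Some (Tagged (fun n => Y n) y).
Proof. exact: pickleK_inv. Qed.

Lemma block_decodeP i n (y : Y n) :
  block_decode i = Some (Tagged (fun n => Y n) y) -> i = block_code y.
Proof. by move=> id; have := @pickle_invK {n : nat & Y n} i; rewrite -/(block_decode i) id. Qed.

Lemma block_code_inj n m (y : Y n) (z : Y m) : block_code y = block_code z ->
  Tagged (fun n => Y n) y = Tagged (fun n => Y n) z.
Proof. by move=> yz; have := block_codeK y; rewrite yz block_codeK => -[]. Qed.

Definition block_sum (v : nat -> R[i]) n : R := \sum_(y : Y n) normc (v (block_code y)) ^+ 2.

Definition block_seq M : seq nat :=
  [seq block_code y | n <- iota 0 M, y <- enum (Y n)].

Lemma block_seq_uniq M : uniq (block_seq M).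
Proof.
apply: allpairs_uniq_dep; first exact: iota_uniq.
  by move=> n _; exact: enum_uniq.
by move=> [n y] [m z] _ _ /= /block_code_inj.
Qed.

Lemma sum_block_seq v M :
  \sum_(i <- block_seq M) normc (v i) ^+ 2 = \sum_(n < M) block_sum v n.
Proof.
rewrite big_allpairs_dep -(big_mkord predT (block_sum v)) /index_iota subn0.
by apply: eq_bigr => n _; rewrite big_enum.
Qed.

Lemma sum_block_le_norm2 x M : \sum_(n < M) block_sum x n <= norm2 x ^+ 2.
Proof. by rewrite -sum_block_seq sum_uniq_le_sqr_norm2 ?block_seq_uniq. Qed.

Lemma sum_le_block_sum (v : nat -> R[i]) (B : R) :
  (forall i, block_decode i = None -> v i = 0) ->
  (forall M, \sum_(n < M) block_sum v n <= B) ->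
  forall N, \sum_(i < N) normc (v i) ^+ 2 <= B.
Proof.
move=> v0 vB N.
(* Finitely many indices meet finitely many blocks; the value 0 is a default for indices outside all
   blocks. *)
pose M := (\max_(i < N) (if block_decode i is Some p then tag p else 0)).+1.
apply: le_trans (vB M); rewrite -sum_block_seq.
rewrite -(big_mkord predT (fun i => normc (v i) ^+ 2)) /=.
rewrite (bigID [pred i | i \in block_seq M]) /= [X in _ + X]big1_seq; last first.
  move=> i /andP[iM]; rewrite mem_index_iota /= => iN.
  rewrite v0 ?Normc.normc0 ?expr0n//.
  case id: (block_decode i) => [[n y]|//]; exfalso; move/negP: iM; apply.
  rewrite (block_decodeP id); apply/allpairsPdep; exists n, y.
  rewrite mem_iota mem_enum; split=> //=; rewrite add0n ltnS.
  pose F (j : 'I_N) := if block_decode j is Some p then tag p else 0.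
  have := @leq_bigmax _ F (Ordinal iN).
  by rewrite /F /= id.
rewrite addr0 -big_filter; set s := [seq _ <- _ | _].
have us : uniq s by rewrite filter_uniq ?iota_uniq.
rewrite [leRHS](bigID [pred i | i \in s]) /= -[leLHS]addr0 lerD//; last first.
  by apply: sumr_ge0 => i _; exact: sqr_ge0.
rewrite -[leRHS]big_filter le_eqVlt; apply/orP; left; apply/eqP/perm_big.
apply: uniq_perm => //; first by rewrite filter_uniq// block_seq_uniq.
move=> i; rewrite [in RHS]mem_filter /=; apply/idP/andP => [is_|[]//].
by split=> //; move: is_; rewrite mem_filter => /andP[].
Qed.

Variable K : forall n, (Y n -> R) -> Y n -> R.
Hypothesis K_lin : forall n (I : finType) (a : I -> R) (g : I -> Y n -> R) t,
  K (fun y => \sum_i a i * g i y) t = \sum_i a i * K (g i) t.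
Hypothesis K_contract : forall n (b : Y n -> R), energy (K b) <= energy b.

(** The maps [K] act on real functions, so real and imaginary parts are treated separately. *)
Definition block_part (b : bool) (v : nat -> R[i]) n (y : Y n) : R :=
  if b then complex.Im (v (block_code y)) else complex.Re (v (block_code y)).

Lemma block_sumE v n : block_sum v n = \sum_b energy (@block_part b v n).
Proof.
rewrite big_bool /= addrC -big_split; apply: eq_bigr => y _.
exact: sqr_normcE.
Qed.

Definition block_fun (v : nat -> R[i]) (i : nat) : R[i] :=
  if block_decode i is Some p then
    K (@block_part false v (tag p)) (tagged p) +i*
    K (@block_part true v (tag p)) (tagged p)
  else 0.

Lemma block_fun_code v n (y : Y n) :
  block_fun v (block_code y) = K (@block_part false v n) y +i* K (@block_part true v n) y.
Proof. by rewrite /block_fun block_codeK. Qed.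

Lemma block_sum_fun v n :
  block_sum (block_fun v) n = \sum_b energy (K (@block_part b v n)).
Proof.
rewrite big_bool /= addrC -big_split; apply: eq_bigr => y _.
by rewrite block_fun_code sqr_normcE.
Qed.

Lemma block_sum_fun_le v n : block_sum (block_fun v) n <= block_sum v n.
Proof. by rewrite block_sum_fun block_sumE; apply: ler_sum. Qed.

Lemma sum_block_fun_le x (B : R) :
  (forall M, \sum_(n < M) block_sum (block_fun x) n <= B) ->
  forall N, \sum_(i < N) normc (block_fun x i) ^+ 2 <= B.
Proof.
by apply: sum_le_block_sum => i id; rewrite /block_fun id.
Qed.

Lemma block_fun_bounded x N :
  \sum_(i < N) normc (block_fun x i) ^+ 2 <= norm2 x ^+ 2.
Proof.
apply: sum_block_fun_le => M; apply: le_trans (sum_block_le_norm2 x M).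
by apply: ler_sum => n _; exact: block_sum_fun_le.
Qed.

Definition block_map x : H := Ell2 (bounded_sqr_summable (block_fun_bounded x)).

Lemma sqr_norm2_block_map_le x (B : R) :
  (forall M, \sum_(n < M) block_sum (block_fun x) n <= B) ->
  norm2 (block_map x) ^+ 2 <= B.
Proof. by move=> xB; apply: sqr_norm2_le => N; exact: sum_block_fun_le. Qed.

Lemma norm2_block_map x : norm2 (block_map x) <= norm2 x.
Proof.
rewrite -(@ler_pXn2r _ 2) ?nnegrE ?norm2_ge0//.
by apply: sqr_norm2_le => N; exact: block_fun_bounded.
Qed.

Lemma K_lin2 n (a b : R) (f g : Y n -> R) t :
  K (fun y => a * f y + b * g y) t = a * K f t + b * K g t.
Proof.
have := @K_lin n _ (fun i : bool => if i then a else b) (fun i => if i then f else g) t.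
rewrite big_bool /= => <-; congr (K _ t).
by apply/funext => y; rewrite big_bool.
Qed.

Lemma block_map_linear : linear block_map.
Proof.
move=> a x y; apply: ell2_ext => i; rewrite ell2D ell2Z /=.
rewrite /block_fun; case: block_decode => [[n t]|] /=; last first.
  by rewrite mulr0 addr0.
case: a => a1 a2; set v := _ *: _ + _.
have vE j : v j = (a1 +i* a2) * x j + y j by [].
(* Both parts of [a x + y] are put in the nested two-term shape of [K_lin2]. *)
have -> : @block_part false v n =
    fun z => 1 * (a1 * block_part false x z + - a2 * block_part true x z) +
             1 * block_part false y z.
  apply/funext => z; rewrite /block_part vE.
  by case: (x _) (y _) => [b c] [d e] /=; ring.
have -> : @block_part true v n =
    fun z => 1 * (a1 * block_part true x z + a2 * block_part false x z) +
             1 * block_part true y z.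
  apply/funext => z; rewrite /block_part vE.
  by case: (x _) (y _) => [b c] [d e] /=; ring.
rewrite !K_lin2; apply/eqP; rewrite eq_complex /=.
by apply/andP; split; apply/eqP; ring.
Qed.

Lemma block_map_bounded_linear : block_map \in @bounded_linear R.
Proof.
apply/bounded_linearP; split; first exact: block_map_linear.
by exists 1 => x; rewrite mul1r norm2_block_map.
Qed.

Definition block_op : bop R := Bop block_map_bounded_linear.

End BlockOperator.

(** * The projections P_f *)

Section FilterProjections.
Variable R : realType.
Notation H := (ell2 R).

(** The error allowed in block [n]; the errors add up to at most [1 / 4]. *)
Definition tol n : R := 2^-1 ^+ (n + 3).

(** The first summand makes the overlaps small, the second exceeds the counting threshold
    [n / tol n]. *)
Definition field_order n : nat := s2val (prime_above (4 * n ^ 2 + n * 2 ^ (n + 3))).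

Lemma field_order_prime n : prime (field_order n).
Proof. exact: s2valP' (prime_above _). Qed.

Lemma field_order_gt n : (4 * n ^ 2 + n * 2 ^ (n + 3) < field_order n)%N.
Proof. exact: s2valP (prime_above _). Qed.

Lemma field_order_tol n : n%:R < (field_order n)%:R * tol n.
Proof.
rewrite /tol exprVn ltr_pdivlMr ?exprn_gt0// -natrX -natrM ltr_nat.
by apply: leq_ltn_trans (field_order_gt n); rewrite leq_addl.
Qed.

Lemma sum_tol_le M : \sum_(n < M) tol n <= 1 / 4.
Proof.
suff -> : \sum_(n < M) tol n = (1 - 2^-1 ^+ M) / 4.
  by rewrite ler_pM2r// gerBl exprn_ge0.
elim: M => [|M IH]; first by rewrite big_ord0 expr0 subrr mul0r.
by rewrite big_ord_recr /= IH /tol exprD [_ ^+ M.+1]exprS; field.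
Qed.

Definition plane n : finType := ('F_(field_order n) * 'F_(field_order n))%type.

Definition block_index n : finType := cube (plane n) n.

Definition curves n : finType := 'rV['F_(field_order n)]_(2 * n).+1.

Notation choices := (forall n, curves n).
Implicit Types f : choices.

Definition curve_vec f n : plane n -> R := @graph_vec R (field_order n) n (f n).

Lemma energy_curve_vec f n : energy (@curve_vec f n) = 1.
Proof. exact/energy_graph_vec/field_order_prime. Qed.

Definition block_proj f n (b : block_index n -> R) (t : block_index n) : R :=
  b t - compl_power (@curve_vec f n) b t.

Lemma block_proj_lin f n (I : finType) (a : I -> R) (g : I -> block_index n -> R) t :
  block_proj f (fun y => \sum_i a i * g i y) t = \sum_i a i * block_proj f (g i) t.
Proof.
rewrite /block_proj compl_power_lin -sumrB.
by apply: eq_bigr => i _; rewrite mulrBr.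
Qed.

Lemma energy_block_proj f n (b : block_index n -> R) :
  energy (block_proj f b) = captured (@curve_vec f n) b.
Proof. by rewrite capturedE// energy_curve_vec. Qed.

Lemma block_proj_contract f n (b : block_index n -> R) :
  energy (block_proj f b) <= energy b.
Proof. by rewrite energy_block_proj captured_le. Qed.

Definition filter_proj f : bop R :=
  block_op (block_proj_lin f) (block_proj_contract f).

Lemma filter_proj_contract f x : norm2 (filter_proj f x) <= norm2 x.
Proof. exact: norm2_block_map. Qed.

(** A curve is chosen in each block by [exists_uncaptured_graph], whose energy hypothesis is
    Bessel's inequality. Over all blocks the captured part of [e k] is at most [1 / 2 + 1 / 4]. *)
Lemma filter_proj_evades (e : nat -> H) :
  (forall k l, inner (e k) (e l) = (k == l)%:R) ->
  exists f, forall k, complex.Re (inner (filter_proj f (e k)) (e k)) <= 7 / 8.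
Proof.
move=> eo.
have ex n : exists j : curves n, forall k,
    \sum_b captured (@graph_vec R (field_order n) n j) (@block_part R block_index b (e k) n) <=
    (\sum_b energy (@block_part R block_index b (e k) n)) / 2 + tol n.
  apply: exists_uncaptured_graph.
  - exact: field_order_prime.
  - by rewrite ltnW// (leq_ltn_trans _ (field_order_gt n))// leq_addr.
  - exact: field_order_tol.
  - move=> K t; apply: le_trans (orthonormal_coord_le1 (block_code t) K eo).
    by apply: ler_sum => k _; rewrite big_bool /= addrC -sqr_normcE.
have [f fP] : exists f : choices, forall n k,
    \sum_b captured (@curve_vec f n) (@block_part R block_index b (e k) n) <=
    (\sum_b energy (@block_part R block_index b (e k) n)) / 2 + tol n.
  exists (fun n => projT1 (cid (ex n))) => n k.
  exact: (projT2 (cid (ex n))).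
exists f => k.
have nek : norm2 (e k) = 1 by apply: norm2_ortho_unit; rewrite eo eqxx.
have P34 : norm2 (filter_proj f (e k)) ^+ 2 <= 3 / 4.
  apply: sqr_norm2_block_map_le => M.
  apply: (@le_trans _ _ (\sum_(n < M) (block_sum block_index (e k) n / 2 + tol n))).
    apply: ler_sum => n _; rewrite block_sum_fun block_sumE.
    under eq_bigr do rewrite energy_block_proj.
    exact: fP.
  rewrite big_split /= -mulr_suml.
  have := sum_block_le_norm2 block_index (e k) M; rewrite nek expr1n.
  by have := sum_tol_le M; lra.
apply: le_trans (Re_inner_le _ _) _; rewrite nek mulr1.
(* Here [3 / 4 < (7 / 8) ^+ 2]. *)
by have := norm2_ge0 (filter_proj f (e k)); nra.
Qed.

Lemma basis_bounded i N :
  \sum_(j < N) normc ((nat_of_ord j == i)%:R : R[i]) ^+ 2 <= 1.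
Proof.
apply: (@le_trans _ _ (\sum_(j < N) (nat_of_ord j == i)%:R)).
  by apply: ler_sum => j _; case: eqP => _; rewrite ?Normc.normc0 ?Normc.normc1 ?expr0n ?expr1n.
have [iN|iN] := ltnP i N.
  rewrite (bigD1 (Ordinal iN))//= eqxx big1 ?addr0// => j ji.
  by rewrite (negPf (ji : nat_of_ord j != i)).
by rewrite big1// => j _; rewrite ltn_eqF// (leq_trans (ltn_ord j)).
Qed.

Definition basis_vec i : H :=
  Ell2 (bounded_sqr_summable (v := fun j => (j == i)%:R) (@basis_bounded i)).

Definition tensor_vec n (ws : nat -> plane n -> R) : H :=
  \sum_(y : block_index n) (@tensor R (plane n) ws n y)%:C *: basis_vec (block_code y).

Lemma tensor_vec_code n ws (y : block_index n) :
  @tensor_vec n ws (block_code y) = (@tensor R (plane n) ws n y)%:C.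
Proof.
rewrite ell2_sum (bigD1 y)// big1 ?addr0 => [|z /andP[_ zy]]; rewrite ell2Z /=.
  by rewrite eqxx mulr1 addr0.
case: eqP => [/block_code_inj /eqP|_]; last by rewrite mulr0.
by rewrite -tag_eqE /tag_eq /= eqxx /= tagged_asE eq_sym (negPf zy).
Qed.

Lemma tensor_vec_out n ws i : (forall y : block_index n, i != block_code y) ->
  @tensor_vec n ws i = 0.
Proof.
move=> iy; rewrite ell2_sum big1// => y _.
by rewrite ell2Z /= (negPf (iy y)) mulr0.
Qed.

Lemma block_part_tensor_vec b n (ws : nat -> plane n -> R) :
  @block_part R block_index b (tensor_vec ws) n =
  fun y => (~~ b)%:R * tensor ws y.
Proof.
apply/funext => y; rewrite /block_part tensor_vec_code.
by case: b; rewrite /= ?mul0r ?mul1r.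
Qed.

Lemma filter_proj_tensor_vec f n (ws : nat -> plane n -> R) i :
  (i < n)%N -> ws i = @curve_vec f n ->
  filter_proj f (tensor_vec ws) = tensor_vec ws.
Proof.
move=> i_n wsi; apply: ell2_ext => j.
have [[y ->]|jn] := pselect (exists y : block_index n, j = block_code y).
  rewrite [LHS]/= block_fun_code !block_part_tensor_vec tensor_vec_code /block_proj.
  rewrite !compl_powerZ -wsi compl_power_tensor ?wsi ?energy_curve_vec//.
  by rewrite !mulr0 !subr0 /= mul0r mul1r.
have jy (y : block_index n) : j != block_code y.
  by apply/eqP => E; apply: jn; exists y.
rewrite (tensor_vec_out _ jy) [LHS]/= /block_fun.
case jd: (block_decode block_index j) => [[m y]|] //=.
(* The form [0 * 0] lets [compl_powerZ] evaluate the operator at zero. *)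
have part0 b : @block_part R block_index b (tensor_vec ws) m = fun=> 0 * 0.
  apply/funext => z; rewrite /block_part tensor_vec_out ?mul0r; first by case: b.
  move=> z'; apply/eqP => /block_code_inj E.
  have mn : m = n := congr1 tag E; subst m.
  by apply: jn; exists y; rewrite (block_decodeP jd).
by rewrite !part0 /block_proj !compl_powerZ !mul0r subrr.
Qed.

Lemma bopD (T : bop R) x y : T (x + y) = T x + T y.
Proof.
by have /bounded_linearP[lT _] := bop_valP T; rewrite -{1}[x]scale1r lT scale1r.
Qed.

Lemma bop0 (T : bop R) : T 0 = 0.
Proof. by apply: (addrI (T 0)); rewrite -bopD !addr0. Qed.

Lemma bopZ (T : bop R) a x : T (a *: x) = a *: T x.
Proof.
have /bounded_linearP[lT _] := bop_valP T.
by have := lT a x 0; rewrite !addr0 bop0 addr0.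
Qed.

(** Block [n = size fs] has one tensor factor for each member of the list, so the tensor of their
    curve vectors is fixed by all of them; it is then normalized. *)
Lemma filter_proj_common_fixed (fs : seq choices) :
  exists x, norm2 x = 1 /\ forall f, List.In f fs -> filter_proj f x = x.
Proof.
pose n := size fs; pose f0 : choices := fun n => 0.
pose ws i := @curve_vec (nth f0 fs i) n.
pose v := tensor_vec ws.
have v0 : 0 < norm2 v.
  rewrite lt_neqAle norm2_ge0 andbT eq_sym; apply/eqP => v0.
  have /eqP := @energy_tensor R (plane n) ws n (fun i => energy_curve_vec _ _).
  rewrite /energy big1 => [|y _]; first by rewrite eq_sym oner_eq0.
  have := @sum_uniq_le_sqr_norm2 _ v [:: block_code (y : block_index n)] isT.
  rewrite big_seq1 tensor_vec_code normc_realC v0 expr0n real_normK ?num_real//=.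
  by move=> le0; apply/eqP; rewrite eq_le le0 sqr_ge0.
exists ((norm2 v)^-1%:C *: v); split.
  by rewrite norm2Z normc_realC ger0_norm ?invr_ge0 ?norm2_ge0// mulVf ?gt_eqF.
move=> f ffs; rewrite bopZ; congr (_ *: _).
have In_nth gs : List.In f gs -> exists2 i, (i < size gs)%N & nth f0 gs i = f.
  by elim: gs => [//|g gs IH] /= [->|/IH[i i_n fi]]; [exists 0%N|exists i.+1].
have [i i_n fi] := In_nth _ ffs.
by apply: (filter_proj_tensor_vec i_n); rewrite /ws fi.
Qed.

End FilterProjections.

(** * Operator norm and states *)

Section OperatorNorm.
Variable R : realType.
Notation H := (ell2 R).
Notation B := (bop R).
Implicit Types S T : B.

Definition rnorm T : R := fine (opnorm T).

Lemma opnorm_le T (M : R) : (forall x, norm2 x <= 1 -> norm2 (T x) <= M) ->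
  (opnorm T <= M%:E)%E.
Proof. by move=> TM; apply: ge_ereal_sup => _ [x x1 <-]; rewrite lee_fin TM. Qed.

Lemma norm2_0 : norm2 (0 : H) = 0.
Proof. by rewrite -(scale0r (0 : H)) norm2Z Normc.normc0 mul0r. Qed.

Lemma opnormE T : opnorm T = (rnorm T)%:E.
Proof.
rewrite fineK// fin_numE; apply/andP; split.
  rewrite gt_eqF// (@lt_le_trans _ _ 0%E) ?ltNy0//.
  by apply: ereal_sup_ubound; exists 0; rewrite /= ?norm2_0 ?bop0 ?norm2_0.
have /bounded_linearP[_ [M TM]] := bop_valP T.
rewrite lt_eqF// (@le_lt_trans _ _ `|M|%:E) ?ltry//.
apply: opnorm_le => x x1; apply: le_trans (TM x) _.
rewrite (le_trans (ler_wpM2r (norm2_ge0 x) (ler_norm M)))//.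
by rewrite -[leRHS]mulr1 ler_wpM2l.
Qed.

Lemma rnorm_le T (M : R) : (forall x, norm2 x <= 1 -> norm2 (T x) <= M) ->
  rnorm T <= M.
Proof. by move=> TM; rewrite -lee_fin -opnormE; exact: opnorm_le. Qed.

Lemma norm2_le_rnorm T x : norm2 x <= 1 -> norm2 (T x) <= rnorm T.
Proof.
move=> x1; rewrite -lee_fin -opnormE.
by apply: ereal_sup_ubound; exists x.
Qed.

Lemma rnorm_ge0 T : 0 <= rnorm T.
Proof.
by have := @norm2_le_rnorm T 0; rewrite bop0 norm2_0; apply; exact: ler01.
Qed.

Lemma rnormD S T : rnorm (S + T) <= rnorm S + rnorm T.
Proof.
apply: rnorm_le => x x1; apply: le_trans (norm2D (S x) (T x)) _.
by rewrite lerD// norm2_le_rnorm.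
Qed.

Lemma rnormZ_le (a : R[i]) T : rnorm (a *: T) <= normc a * rnorm T.
Proof.
apply: rnorm_le => x x1; rewrite (norm2Z a (T x)).
by rewrite ler_wpM2l ?normc_ge0// norm2_le_rnorm.
Qed.

Lemma rnorm_sublinear : sublinear rnorm.
Proof.
split=> [|c T]; first exact: rnormD.
rewrite le_eqVlt => /predU1P[<-|c0].
  rewrite mul0r; apply/eqP; rewrite eq_le rnorm_ge0 andbT.
  by rewrite (le_trans (rnormZ_le _ _))// normc_realC normr0 mul0r.
apply/eqP; rewrite eq_le; apply/andP; split.
  by rewrite (le_trans (rnormZ_le _ _))// normc_realC gtr0_norm.
have := rnormZ_le c^-1%:C (c%:C *: T).
rewrite normc_realC gtr0_norm ?invr_gt0//.
rewrite scalerA -rmorphM /= mulVf ?gt_eqF// scale1r.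
by rewrite mulrC ler_pdivlMr// mulrC.
Qed.

Lemma id_bounded_linear : (fun x : H => x) \in @bounded_linear R.
Proof. by apply/bounded_linearP; split=> //; exists 1 => x; rewrite mul1r. Qed.

Definition id_op : B := Bop id_bounded_linear.

End OperatorNorm.

(** * From real functionals to pure states *)

Section States.
Variable R : realType.
Notation H := (ell2 R).
Notation B := (bop R).
Implicit Types (S T : B) (u : B -> R).

Definition im : R[i] := 0 +i* 1.

(** The only possible complex-linear functional with real part [u]: the imaginary part at [T] is
    minus the real part at [im *: T]. *)
Definition complexify u T : R[i] := u T +i* (- u (im *: T)).

Lemma im_sqr : im * im = -1.
Proof. by apply/eqP; rewrite eq_complex /=; apply/andP; split; apply/eqP; ring. Qed.

Lemma complexE (a : R[i]) : a = (complex.Re a)%:C + (complex.Im a)%:C * im.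
Proof.
by case: a => a b; apply/eqP; rewrite eq_complex /=; apply/andP; split; apply/eqP; ring.
Qed.

Lemma complexify_scalar u : real_linear u -> scalar (complexify u).
Proof.
move=> [uD uZ] a S T.
have E V : u (a *: V) = complex.Re a * u V + complex.Im a * u (im *: V).
  by rewrite {1}[a]complexE scalerDl uD uZ -scalerA uZ.
have N V : u (- V) = - u V.
  by have := uZ (-1) V; rewrite raddfN /= scaleN1r mulN1r.
rewrite /complexify scalerDr !uD scalerA (mulrC im) -scalerA !E scalerA.
rewrite im_sqr scaleN1r N; case: a {E} => a b; apply/eqP.
by rewrite eq_complex /=; apply/andP; split; apply/eqP; ring.
Qed.

Section Scalar.
Variable psi : B -> R[i].
Hypothesis lpsi : scalar psi.

Lemma scalarD S T : psi (S + T) = psi S + psi T.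
Proof. by rewrite -{1}[S]scale1r lpsi mul1r. Qed.

Lemma scalar0 : psi 0 = 0.
Proof. by apply: (addrI (psi 0)); rewrite -scalarD !addr0. Qed.

Lemma scalarZ a T : psi (a *: T) = a * psi T.
Proof. by rewrite -[a *: T]addr0 lpsi scalar0 addr0. Qed.

Lemma Re_scalar_linear : real_linear (fun T => complex.Re (psi T)).
Proof.
split=> [S T|c T]; first by rewrite scalarD raddfD.
by rewrite scalarZ; case: (psi T) => a b /=; ring.
Qed.

Lemma complexify_Re : complexify (fun T => complex.Re (psi T)) = psi.
Proof.
apply/funext => T; rewrite /complexify scalarZ; case: (psi T) => a b /=.
by apply/eqP; rewrite eq_complex /=; apply/andP; split; apply/eqP; ring.
Qed.

(** Multiplying [T] by the conjugate of [psi T] makes the value real, equal to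
    [normc (psi T) ^+ 2]. *)
Lemma normc_scalar_le u : (forall T, complex.Re (psi T) <= u T) ->
  (forall a T, u (a *: T) <= normc a * u T) ->
  forall T, normc (psi T) <= u T.
Proof.
move=> psiu uZ T; have := normc_ge0 (psi T).
rewrite le_eqVlt => /predU1P[p0|p0].
  by rewrite -p0 (le_trans _ (psiu T))// (Normc.eq0_normc (esym p0)).
have := le_trans (psiu (conjc (psi T) *: T)) (uZ _ _).
rewrite scalarZ mul_conj_normc /=.
have -> : normc (conjc (psi T)) = normc (psi T).
  by case: (psi T) => a b /=; rewrite sqrrN.
by rewrite expr2 ler_pM2l.
Qed.

End Scalar.

Lemma state_le_rnorm psi T : is_state psi -> normc (psi T) <= rnorm T.
Proof.
move=> [lpsi _ npsi]; apply/ler_addgt0Pr => eps eps0.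
(* The [eps] allows division even when [rnorm T] is 0. *)
set r := rnorm T + eps; have r0 : 0 < r by rewrite ltr_wpDl ?rnorm_ge0.
have : (normc (psi (r^-1%:C *: T)) <= 1)%R.
  rewrite -lee_fin -npsi; apply: ereal_sup_ubound; exists (r^-1%:C *: T) => //=.
  rewrite opnormE lee_fin (le_trans (rnormZ_le _ _))//.
  rewrite normc_realC gtr0_norm ?invr_gt0// ler_pdivrMl// mulr1.
  by rewrite lerDl ltW.
rewrite scalarZ// Normc.normcM normc_realC gtr0_norm ?invr_gt0//.
by rewrite ler_pdivrMl// mulr1.
Qed.

(* As the numerical range of [z T] lies in the right half-plane, [1 - eps z T]
   has norm at most [1 + (eps M)^2]; let [eps] tend to 0. *)
Lemma contractive_unital_ge0 u (T : B) (z : R[i]) :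
  real_linear u -> (forall S, u S <= rnorm S) -> u (@id_op R) = 1 ->
  (forall x : H, 0 <= complex.Re (z * inner (T x) x)) -> 0 <= u (z *: T).
Proof.
move=> [uD uZ] up u1 zT; pose M := rnorm (z *: T).
have M0 : 0 <= M by exact: rnorm_ge0.
have step (eps : R) : 0 < eps -> - (M ^+ 2 * eps) <= u (z *: T).
  move=> eps0.
  have nS : rnorm (@id_op R + (- eps)%:C *: (z *: T)) <= 1 + (eps * M) ^+ 2.
    apply: rnorm_le => x x1.
    have E : (@id_op R + (- eps)%:C *: (z *: T)) x = x + (- eps)%:C *: (z *: T x).
      by [].
    have c0 : 0 <= 1 + (eps * M) ^+ 2 by rewrite addr_ge0 ?sqr_ge0.
    rewrite E -(@ler_pXn2r _ 2) ?nnegrE ?norm2_ge0// addrC sqr_norm2D.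
    rewrite norm2Z normc_realC normrN gtr0_norm// !innerZl.
    have := zT x; set w := z * _ => w0.
    have -> : complex.Re ((- eps)%:C * w) = - eps * complex.Re w.
      by case: w {w0} => a b /=; ring.
    have n1 : norm2 (z *: T x) <= M := @norm2_le_rnorm R (z *: T) x x1.
    have n0 : 0 <= norm2 (z *: T x) by exact: norm2_ge0.
    have x0 := norm2_ge0 x.
    have h1 : (eps * norm2 (z *: T x)) ^+ 2 <= (eps * M) ^+ 2.
      by rewrite ler_pXn2r ?nnegrE ?mulr_ge0// ?ler_pM2l// ltW.
    have h2 : norm2 x ^+ 2 <= 1 by rewrite expr_le1.
    have h3 : 0 <= eps * complex.Re w by rewrite mulr_ge0// ltW.
    have h4 := sqr_ge0 (eps * M).
    move: h1 h2 h3 h4; rewrite [(1 + _) ^+ 2]sqrrD expr1n mul1r.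
    have h5 := sqr_ge0 ((eps * M) ^+ 2); lra.
  have := le_trans (up _) nS; rewrite uD u1 uZ => h.
  by rewrite -(ler_pM2l eps0); lra.
rewrite leNgt; apply/negP => uneg.
have [MM|MM] := eqVneq M 0.
  by have := step 1 ltr01; rewrite MM; lra.
have Mp : 0 < M by rewrite lt_neqAle eq_sym MM.
(* This [eps] turns the bound into [u / 2 <= u], absurd for a negative value. *)
have := step (- u (z *: T) / (2 * M ^+ 2)).
rewrite divr_gt0 ?oppr_gt0 ?mulr_gt0 ?exprn_gt0// => /(_ isT).
rewrite (_ : M ^+ 2 * _ = - u (z *: T) / 2); last by field.
lra.
Qed.

Lemma complexify_state u : real_linear u -> (forall S, u S <= rnorm S) ->
  u (@id_op R) = 1 -> is_state (complexify u).
Proof.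
move=> lu up u1; have lphi := complexify_scalar lu.
have le_phi T : normc (complexify u T) <= rnorm T.
  by apply: normc_scalar_le => // a S; exact: rnormZ_le.
split=> //.
- move=> S S' adj; set T := bop_comp S' S.
  have Tx x : inner (T x) x = (norm2 (S x) ^+ 2)%:C.
    by rewrite -[T x]/(S' (S x)) inner_conj -adj inner_diag conjc_real.
  (* Taking [z] to be [im] and [- im] shows that the value at [T] is real; [z = 1] shows that it is
     nonnegative. *)
  have u0 z : 0 <= complex.Re z -> 0 <= u (z *: T).
    move=> z0; apply: contractive_unital_ge0 => // x; rewrite Tx.
    have := mulr_ge0 z0 (sqr_ge0 (norm2 (S x))).
    by case: z {z0} => a b /=; rewrite mulr0 subr0.
  have uT : u (im *: T) = 0.
    apply/eqP; rewrite eq_le u0 ?lexx// andbT.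
    have := u0 (- im); rewrite /= oppr0 lexx => /(_ isT).
    by have [_ uZ] := lu; have := uZ (-1) (im *: T);
       rewrite raddfN /= scaleN1r scaleNr mulN1r => ->; rewrite oppr_ge0.
  rewrite /complexify uT oppr0 lecE /= eqxx /=.
  by have := u0 1; rewrite scale1r; apply; rewrite /= ler01.
- apply/eqP; rewrite eq_le; apply/andP; split.
    apply: ge_ereal_sup => _ [T T1 <-]; rewrite lee_fin.
    by apply: le_trans (le_phi T) _; rewrite -lee_fin -opnormE.
  have id1 : (opnorm (@id_op R) <= 1)%E by exact: opnorm_le.
  apply: le_trans (ereal_sup_ubound _); last by exists (@id_op R).
  rewrite lee_fin /complexify u1 /= -[leLHS]sqrtr1.
  by rewrite ler_sqrt ?addr_ge0 ?sqr_ge0// expr1n lerDl sqr_ge0.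
Qed.

Lemma real_linear_le_eq u v : real_linear u -> real_linear v ->
  (forall T, u T <= v T) -> u = v.
Proof.
move=> [_ uZ] [_ vZ] uv; apply/funext => T; apply/eqP; rewrite eq_le uv /=.
have := uv ((-1)%:C *: T); rewrite uZ vZ; lra.
Qed.

(** The real parts of [psi1] and [psi2] lie below [rnorm], hence below [u] by the face property. A
    linear functional below a linear one equals it, and the real part determines the state. *)
Lemma complexify_pure u : real_linear u -> (forall S, u S <= @rnorm R S) ->
  u (@id_op R) = 1 -> facial (@rnorm R) u -> is_pure_state (complexify u).
Proof.
move=> lu up u1 fu; split; first exact: complexify_state.
move=> psi1 psi2 t s1 s2 t01 phiE.
have [l1 _ _] := s1; have [l2 _ _] := s2.
have le_Re psi T : is_state psi -> complex.Re (psi T) <= rnorm T.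
  move=> sp; apply: le_trans (state_le_rnorm T sp).
  case: (psi T) => a b /=; apply: le_trans (ler_norm a) _.
  by rewrite -sqrtr_sqr ler_sqrt ?addr_ge0 ?sqr_ge0// lerDl sqr_ge0.
have phi_le T : t * complex.Re (psi1 T) + (1 - t) * complex.Re (psi2 T) <= u T.
  have /(congr1 (@complex.Re R)) := phiE T.
  by case: (psi1 T) (psi2 T) => [a b] [c d] /= ->; lra.
have [u1le u2le] := fu t _ _ t01 (Re_scalar_linear l1) (Re_scalar_linear l2)
  (fun T => le_Re _ T s1) (fun T => le_Re _ T s2) phi_le.
have E1 := real_linear_le_eq (Re_scalar_linear l1) lu u1le.
have E2 := real_linear_le_eq (Re_scalar_linear l2) lu u2le.
by rewrite -(complexify_Re l1) -(complexify_Re l2) E1 E2.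
Qed.

End States.

(** * The cone containing the projections, and the conclusion *)

Section Main.
Variable R : realType.
Notation H := (ell2 R).
Notation B := (bop R).
Notation choices := (forall n, curves n).

(* Finitely many projections have a common fixed unit vector, so [rnorm S = c]:
   this is what makes [rnorm] additive on these operators. *)
Definition eventually_scalar (S : B) : Prop :=
  exists (fs : seq choices) (c : R), [/\ 0 <= c, rnorm S <= c &
    forall x : H, (forall f, List.In f fs -> filter_proj R f x = x) ->
      S x = c%:C *: x].

Lemma rnorm_eventually_scalar (S : B) fs (c : R) : 0 <= c -> rnorm S <= c ->
  (forall x : H, (forall f, List.In f fs -> filter_proj R f x = x) ->
    S x = c%:C *: x) -> rnorm S = c.
Proof.
move=> c0 Sc Sx; apply/eqP; rewrite eq_le Sc /=.
have [x [x1 xfix]] := filter_proj_common_fixed R fs.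
have := @norm2_le_rnorm R S x; rewrite x1 lexx => /(_ isT).
by rewrite (Sx x xfix) norm2Z x1 mulr1 normc_realC ger0_norm.
Qed.

(** On the common fixed vectors of the concatenated lists, [S + T] acts as [c + d], so its norm
    attains the triangle bound. *)
Lemma eventually_scalarD (S T : B) : eventually_scalar S -> eventually_scalar T ->
  eventually_scalar (S + T) /\ rnorm (S + T) = rnorm S + rnorm T.
Proof.
move=> [fs [c [c0 Sc Sx]]] [gs [d [d0 Td Tx]]].
have cd0 : 0 <= c + d by rewrite addr_ge0.
have STc : rnorm (S + T) <= c + d by rewrite (le_trans (rnormD _ _))// lerD.
have STx (x : H) : (forall f, List.In f (fs ++ gs) -> filter_proj R f x = x) ->
    (S + T) x = (c + d)%:C *: x.
  move=> xfix; rewrite -[(S + T) x]/(S x + T x) rmorphD /= scalerDl.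
  congr (_ + _).
    by apply: Sx => f ff; apply: xfix; apply: List.in_or_app; left.
  by apply: Tx => f ff; apply: xfix; apply: List.in_or_app; right.
split; first by exists (fs ++ gs), (c + d).
by rewrite (rnorm_eventually_scalar cd0 STc STx)
  (rnorm_eventually_scalar c0 Sc Sx) (rnorm_eventually_scalar d0 Td Tx).
Qed.

Lemma eventually_scalar_cone : convex_cone eventually_scalar.
Proof.
split.
- exists [::], 0; split=> //; last by move=> x _; rewrite scale0r.
  by apply: rnorm_le => x _; rewrite -[(0 : B) x]/(0 : H) norm2_0.
- by move=> S T eS eT; have [] := eventually_scalarD eS eT.
- move=> r S r0 [fs [c [c0 Sc Sx]]]; exists fs, (r * c); split.
  + exact: mulr_ge0.
  + by have [_ ->//] := rnorm_sublinear R; rewrite ler_wpM2l.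
  + by move=> x /Sx E; rewrite -[(r%:C *: S) x]/(r%:C *: S x) E scalerA rmorphM.
Qed.

(** Serves for the identity, with the empty list, and for [filter_proj R f], with the list of [f]
    alone. *)
Lemma eventually_scalar_unit (S : B) fs :
  (forall x : H, norm2 (S x) <= norm2 x) ->
  (forall x : H, (forall f, List.In f fs -> filter_proj R f x = x) -> S x = x) ->
  eventually_scalar S /\ rnorm S = 1.
Proof.
move=> S1 Sx; have S1' : rnorm S <= 1.
  by apply: rnorm_le => x; apply: le_trans.
have Sx' (x : H) : (forall f, List.In f fs -> filter_proj R f x = x) ->
    S x = 1%:C *: x by move=> /Sx ->; rewrite scale1r.
split; first by exists fs, 1.
exact: rnorm_eventually_scalar ler01 S1' Sx'.
Qed.

End Main.

Theorem theorem12 (R : realType) :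
  exists phi : bop R -> R[i], is_pure_state phi /\ ~ diagonalizable_state phi.
Proof.
have [u [lu up fu uC]] := extreme_linear (rnorm_sublinear R)
  (eventually_scalar_cone R) (fun S T eS eT => proj2 (eventually_scalarD eS eT)).
have u1 : u (@id_op R) = 1.
  have [Cid nid] := @eventually_scalar_unit R (@id_op R) [::]
    (fun=> lexx _) (fun _ _ => erefl).
  by rewrite (uC _ Cid).
exists (complexify u); split; first exact: complexify_pure.
move=> [e [U [[eo _] UU eU]]].
have [f fP] := filter_proj_evades eo.
have [Cf nf] : eventually_scalar (filter_proj R f) /\ rnorm (filter_proj R f) = 1.
  apply: (@eventually_scalar_unit R _ [:: f]) => [x|x xf].
    exact: filter_proj_contract.
  by apply: xf; left.
(* The state has real part 1 at [filter_proj R f]. A set in [U] is nonempty, so some diagonal entry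
   would be within [1 / 8] of the value, against the bound [7 / 8]. *)
have h8 : 0 < 1 / 8 :> R by [].
have /filter_ex[k] := eU (filter_proj R f) _ h8.
rewrite /mkset /complexify (uC _ Cf) nf; move: (fP k).
case: (inner _ _) => a b /= a78 lt8.
have : `|a - 1| < 1 / 8.
  apply: le_lt_trans lt8; rewrite -sqrtr_sqr ler_sqrt ?addr_ge0 ?sqr_ge0//.
  by rewrite lerDl sqr_ge0.
by rewrite ltr_norml => /andP[]; lra.
Qed.
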